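(* Assume that the $(\alpha,z,y)$-Johnson Coverage$^*$ problem is NP-hard. Then for every constant $\varepsilon>0$, given as input a point-set $\mathcal{P}\subset\{0,1\}^d$ of size $n$ (with $d=O(\log n)$) and a parameter $k$, it is NP-hard to distinguish between the following two cases: - Completeness: there exist $\mathcal{C}'=\{c_1,\dots,c_k\}\subseteq\mathbb{R}^d$ and $\sigma:\mathcal{P}\to\mathcal{C}'$ such that $\sum_{a\in\mathcal{P}}\|a-\sigma(a)\|_1^2\le \rho\, n(\log n)^2$. - Soundness: for every $\mathcal{C}'=\{c_1,\dots,c_k\}\subseteq\mathbb{R}^d$ and every $\sigma:\mathcal{P}\to\mathcal{C}'$, $\sum_{a\in\mathcal{P}}\|a-\sigma(a)\|_1^2\ge\left(\alpha+(1-\alpha)\frac{(z-y+1)^2}{(z-y)^2}-\varepsilon\right)\rho\, n(\log n)^2$, for some constant $\rho>0$.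
   Context: Here $\|a-b\|_1=\sum_i|a_i-b_i|$. $(\alpha,z,y)$-Johnson Coverage problem (for integers $z>y\ge1$): given a universe $U=[N]=\{1,\dots,N\}$, a collection $E\subseteq\binom{[N]}{z}$ of $z$-element subsets of $U$, and a parameter $k$, distinguish between: (Completeness) there are $S_1,\dots,S_k\in\binom{[N]}{y}$ such that every $T\in E$ contains some $S_i$; (Soundness) for all $S_1,\dots,S_k\in\binom{[N]}{y}$, the number of $T\in E$ containing at least one $S_i$ is at most $\alpha|E|$. The $(\alpha,z,y)$-Johnson Coverage$^*$ problem is its special case restricted to instances satisfying $|E|=\omega(k\cdot|U|^{z-y-1})$. *)

(* Defs.v *)
(* MathComp / MathComp-Analysis. *)
From HB Require Import structures.
From mathcomp Require Import all_boot all_order all_algebra.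
From mathcomp Require Import boolp classical_sets reals topology normedtype.
From mathcomp Require Import sequences exp.

Set Implicit Arguments.
Unset Strict Implicit.
Unset Printing Implicit Defensive.

Import Order.TTheory GRing.Theory Num.Theory.
Import numFieldNormedType.Exports.

Local Open Scope ring_scope.

(** * Polynomial time

    The machine model is Jones' WHILE language over binary trees
    ("Computability and Complexity from a Programming Perspective"), with one
    change: an assignment costs the size of the value it writes, instead of
    O(1).  With unit-cost assignments, [X := cons X X] repeated n times would
    build a tree of size 2^n in n steps.  Here the sizes of all stored values
    stay bounded by the input size plus the time spent, so the model and Turing
    machines simulate each other with polynomial overhead. *)

Inductive data : Type := Nil | Cons of data & data.

Fixpoint dsize (x : data) : nat :=
  if x is Cons a b then (dsize a + dsize b).+1 else 1%N.

Definition dhd (x : data) : data := if x is Cons a _ then a else Nil.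
Definition dtl (x : data) : data := if x is Cons _ b then b else Nil.

Inductive expr : Type :=
  | EVar of nat
  | ENil
  | ECons of expr & expr
  | EHd of expr
  | ETl of expr.

Inductive cmd : Type :=
  | CSkip
  | CAssign of nat & expr
  | CSeq of cmd & cmd
  | CIf of expr & cmd & cmd
  | CWhile of expr & cmd.

Definition store := nat -> data.

Fixpoint eval (e : expr) (s : store) : data :=
  match e with
  | EVar i => s i
  | ENil => Nil
  | ECons a b => Cons (eval a s) (eval b s)
  | EHd a => dhd (eval a s)
  | ETl a => dtl (eval a s)
  end.

Definition update (s : store) (i : nat) (v : data) : store :=
  [eta s with i |-> v].

(* [exec c s t s']: started in store s, the program c halts in store s' after
   time t.  [Nil] is the false value of tests. *)
Inductive exec : cmd -> store -> nat -> store -> Prop :=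
  | exec_skip s : exec CSkip s 1 s
  | exec_assign i e s :
      exec (CAssign i e) s (dsize (eval e s)).+1 (update s i (eval e s))
  | exec_seq c1 c2 s s1 s2 t1 t2 :
      exec c1 s t1 s1 -> exec c2 s1 t2 s2 ->
      exec (CSeq c1 c2) s (t1 + t2)%N s2
  | exec_if_true e c1 c2 s s' t :
      eval e s <> Nil -> exec c1 s t s' -> exec (CIf e c1 c2) s t.+1 s'
  | exec_if_false e c1 c2 s s' t :
      eval e s = Nil -> exec c2 s t s' -> exec (CIf e c1 c2) s t.+1 s'
  | exec_while_true e c s s1 s2 t1 t2 :
      eval e s <> Nil -> exec c s t1 s1 -> exec (CWhile e c) s1 t2 s2 ->
      exec (CWhile e c) s (t1 + t2).+1 s2
  | exec_while_false e c s :
      eval e s = Nil -> exec (CWhile e c) s 1 s.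

Definition init_store (x : data) : store := update (fun=> Nil) 0 x.

(* Every polynomial is dominated by some n ^ m + m.  Input and output are in
   variable 0. *)
Definition polytime (f : data -> data) : Prop :=
  exists (c : cmd) (m : nat), forall x : data,
    exists (t : nat) (s : store),
      [/\ exec c (init_store x) t s, (t <= dsize x ^ m + m)%N & s 0%N = f x].

(** * NP and NP-hardness of promise problems *)

Definition in_NP (L : data -> Prop) : Prop :=
  exists (V : data -> data) (m : nat),
    polytime V /\
    forall x : data, L x <->
      exists w : data, (dsize w <= dsize x ^ m + m)%N /\ V (Cons x w) <> Nil.

(* It is NP-hard (under Karp reductions) to distinguish the inputs in [yes]
   from those in [no]. *)
Definition NP_hard (yes no : data -> Prop) : Prop :=
  forall L : data -> Prop, in_NP L ->
    exists f : data -> data,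
      polytime f /\
      forall x : data, (L x -> yes (f x)) /\ (~ L x -> no (f x)).

(** * Encodings

    Numbers are written in unary: the ground set [N] is part of the input, and
    k can be capped at the number of sets or points listed.  A finite
    collection is encoded by any duplicate-free list of its members. *)

Definition enc_list (s : seq data) : data := foldr Cons Nil s.
Definition enc_nat (n : nat) : data := enc_list (nseq n Nil).
Definition enc_bool (b : bool) : data := if b then Cons Nil Nil else Nil.

(* [enum T] lists T in increasing order.  The universe {1, ..., N} is
   represented by 'I_N = {0, ..., N - 1}. *)
Definition enc_subset (N : nat) (T : {set 'I_N}) : data :=
  enc_list [seq enc_nat i | i : 'I_N <- enum T].

Definition enc_point (d : nat) (a : d.-tuple bool) : data :=
  enc_list [seq enc_bool b | b <- a].

Definition encodes_johnson (N : nat) (E : {set {set 'I_N}}) (k : nat)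
    (x : data) : Prop :=
  exists2 s : seq {set 'I_N}, perm_eq s (enum E) &
    x = Cons (enc_nat N)
          (Cons (enc_list [seq enc_subset T | T <- s]) (enc_nat k)).

Definition encodes_kmeans (d : nat) (P : {set d.-tuple bool}) (k : nat)
    (x : data) : Prop :=
  exists2 s : seq (d.-tuple bool), perm_eq s (enum P) &
    x = Cons (enc_list [seq enc_point a | a <- s]) (enc_nat k).

(** * Johnson Coverage *)

(* If E were empty, the instance would satisfy both completeness and
   soundness, for every alpha. *)
Definition johnson_instance (z N : nat) (E : {set {set 'I_N}}) (k : nat) :
    Prop :=
  [/\ (forall T, T \in E -> #|T| = z), E != finset.set0 & (0 < k)%N].

Definition johnson_complete (y N : nat) (E : {set {set 'I_N}}) (k : nat) :
    Prop :=
  exists S : 'I_k -> {set 'I_N},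
    (forall i, #|S i| = y) /\
    (forall T, T \in E -> exists i, S i \subset T).

Definition johnson_sound (R : realType) (alpha : R) (y N : nat)
    (E : {set {set 'I_N}}) (k : nat) : Prop :=
  forall S : 'I_k -> {set 'I_N}, (forall i, #|S i| = y) ->
    #|[set T in E | [exists i, S i \subset T]]|%:R <= alpha * #|E|%:R.

(* |E| >= g(|U|) * k * |U|^(z-y-1) *)
Definition johnson_star (R : realType) (g : nat -> R) (z y N : nat)
    (E : {set {set 'I_N}}) (k : nat) : Prop :=
  g N * k%:R * N%:R ^+ (z - y - 1) <= #|E|%:R.

Definition johnson_star_yes (R : realType) (g : nat -> R) (z y : nat)
    (x : data) : Prop :=
  exists (N : nat) (E : {set {set 'I_N}}) (k : nat),
    [/\ encodes_johnson E k x, johnson_instance z E k,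
        johnson_star g z y E k & johnson_complete y E k].

Definition johnson_star_no (R : realType) (g : nat -> R) (alpha : R)
    (z y : nat) (x : data) : Prop :=
  exists (N : nat) (E : {set {set 'I_N}}) (k : nat),
    [/\ encodes_johnson E k x, johnson_instance z E k,
        johnson_star g z y E k & johnson_sound alpha y E k].

(* |E| = omega(k |U|^(z-y-1)) along the family of instances: the factor g
   tends to infinity with |U|. *)
Definition johnson_star_NP_hard (R : realType) (alpha : R) (z y : nat) :
    Prop :=
  exists g : nat -> R,
    (g n @[n --> \oo] --> +oo)%classic /\
    NP_hard (johnson_star_yes g z y) (johnson_star_no g alpha z y).

(** * k-means in the l_1 metric *)

Definition l1_dist (R : realType) (d : nat) (a : d.-tuple bool)
    (c : 'rV[R]_d) : R :=
  \sum_(i < d) `|(tnth a i)%:R - c 0 i|.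

Definition kmeans_cost (R : realType) (d : nat) (P : {set d.-tuple bool})
    (sigma : d.-tuple bool -> 'rV[R]_d) : R :=
  \sum_(a in P) l1_dist a (sigma a) ^+ 2.

Definition maps_into_centers (R : realType) (d : nat) (P : {set d.-tuple bool})
    (k : nat) (c : 'I_k -> 'rV[R]_d) (sigma : d.-tuple bool -> 'rV[R]_d) :
    Prop :=
  forall a, a \in P -> exists i, sigma a = c i.

(* For n = 1 both thresholds rho n (log n)^2 would be 0, and the instance would
   satisfy both completeness and soundness. *)
Definition kmeans_instance (R : realType) (C : R) (d : nat)
    (P : {set d.-tuple bool}) (k : nat) : Prop :=
  [/\ (1 < #|P|)%N, (0 < k)%N & d%:R <= C * ln (#|P|%:R : R)].

Definition kmeans_complete (R : realType) (rho : R) (d : nat)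
    (P : {set d.-tuple bool}) (k : nat) : Prop :=
  exists (c : 'I_k -> 'rV[R]_d) (sigma : d.-tuple bool -> 'rV[R]_d),
    maps_into_centers P c sigma /\
    kmeans_cost P sigma <= rho * #|P|%:R * ln (#|P|%:R) ^+ 2.

Definition kmeans_sound (R : realType) (rho gamma : R) (d : nat)
    (P : {set d.-tuple bool}) (k : nat) : Prop :=
  forall (c : 'I_k -> 'rV[R]_d) (sigma : d.-tuple bool -> 'rV[R]_d),
    maps_into_centers P c sigma ->
    gamma * rho * #|P|%:R * ln (#|P|%:R) ^+ 2 <= kmeans_cost P sigma.

Definition kmeans_yes (R : realType) (C rho : R) (x : data) : Prop :=
  exists (d : nat) (P : {set d.-tuple bool}) (k : nat),
    [/\ encodes_kmeans P k x, kmeans_instance C P k & kmeans_complete rho P k].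

Definition kmeans_no (R : realType) (C rho gamma : R) (x : data) : Prop :=
  exists (d : nat) (P : {set d.-tuple bool}) (k : nat),
    [/\ encodes_kmeans P k x, kmeans_instance C P k &
        kmeans_sound rho gamma P k].

(* Main.v *)
(** Every vertex of a Johnson Coverage instance is replaced by a block of
    l = log2 n coordinates out of q l, where n = |E| and q is a constant; the
    blocks are the one-hot images of the words of a greedy code over q letters,
    so that any two of them are nearly disjoint, and T in E becomes the union of
    the blocks of its elements.  Up to the factor l, the distances are then
    those between sets: |T| - |S| for S inside T.

    For soundness, fix a center c, clipped to [0,1].  Only boundedly many
    vertices are heavy, meaning that c has a constant fraction of mass on their
    block.  The sets T with more than y heavy vertices are negligible: there are
    O(N^(z-y-1)) of them for each center, which is o(n) in total by the
    assumption |E| = omega(k N^(z-y-1)).  Any other T has distance at least about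
    z - y from c, and at least about z - y + 1 unless T contains exactly y heavy
    vertices; by inclusion-exclusion these y vertices must be the same for all
    such T, so they form a set S of size y covering all the close T.

    The bound |E| = omega(...) is void for small N; these instances, with k
    capped, are finitely many, and the reduction looks their answer up.  For
    alpha >= 1 the asserted gap is at most 1 and a constant reduction suffices. *)
Require Import Defs.
From HB Require Import structures.
From mathcomp Require Import all_boot all_order all_algebra.
From mathcomp Require Import boolp reals exp normedtype.
From mathcomp Require Import zify ring lra.
(* [Nil] and [Cons] are also notations of seq.v. *)
Import Defs.

Set Implicit Arguments.
Unset Strict Implicit.
Unset Printing Implicit Defensive.

Import Order.TTheory GRing.Theory Num.Theory.

(** * Polynomial-time computable functions *)

Lemma dsize_gt0 x : 0 < dsize x.
Proof. by case: x. Qed.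

Fixpoint expr_bound (e : expr) : nat :=
  match e with
  | EVar i => i.+1
  | ENil => 0
  | ECons a b => maxn (expr_bound a) (expr_bound b)
  | EHd a | ETl a => expr_bound a
  end.

Fixpoint cmd_bound (c : cmd) : nat :=
  match c with
  | CSkip => 0
  | CAssign i e => maxn i.+1 (expr_bound e)
  | CSeq a b => maxn (cmd_bound a) (cmd_bound b)
  | CIf e a b => maxn (expr_bound e) (maxn (cmd_bound a) (cmd_bound b))
  | CWhile e a => maxn (expr_bound e) (cmd_bound a)
  end.

Lemma updateE s i v j : update s i v j = if j == i then v else s j.
Proof. by []. Qed.

Lemma eval_local e v s u :
  expr_bound e <= v -> (forall j, j < v -> s j = u j) -> eval e s = eval e u.
Proof.
move=> + su; elim: e => //= [a IHa b IHb|a IHa av|a IHa av].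
- by rewrite geq_max => /andP[/IHa-> /IHb->].
- by rewrite IHa.
- by rewrite IHa.
Qed.

(** A program neither reads nor writes variables from [cmd_bound c] on, so it runs unchanged inside
    a larger program that keeps its own data there. *)
Lemma exec_frame c s t s' : exec c s t s' ->
  forall v u, cmd_bound c <= v -> (forall j, j < v -> s j = u j) ->
  exists u', [/\ exec c u t u', forall j, j < v -> s' j = u' j &
                 forall j, v <= j -> u' j = u j].
Proof.
elim=> {c s t s'} /=.
- by move=> s v u _ su; exists u; split=> //; exact: exec_skip.
- move=> i e s v u; rewrite geq_max => /andP[iv ev] su.
  rewrite (eval_local ev su); exists (update u i (eval e u)).
  split; first exact: exec_assign.
    by move=> j jv; rewrite !updateE su.
  by move=> j jv; rewrite updateE; case: eqP => // ji; lia.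
- move=> c1 c2 s s1 s2 t1 t2 _ IH1 _ IH2 v u; rewrite geq_max => /andP[v1 v2].
  move=> /(IH1 _ _ v1)[u1 [e1 su1 f1]].
  have [u2 [e2 su2 f2]] := IH2 _ _ v2 su1.
  exists u2; split=> //; first exact: exec_seq e1 e2.
  by move=> j jv; rewrite f2 ?f1.
- move=> e c1 c2 s s' t es _ IH v u; rewrite !geq_max => /and3P[v0 v1 v2] su.
  have [u1 [e1 su1 f1]] := IH _ _ v1 su.
  by exists u1; split=> //; apply: exec_if_true => //; rewrite -(eval_local v0 su).
- move=> e c1 c2 s s' t es _ IH v u; rewrite !geq_max => /and3P[v0 v1 v2] su.
  have [u1 [e1 su1 f1]] := IH _ _ v2 su.
  by exists u1; split=> //; apply: exec_if_false => //; rewrite -(eval_local v0 su).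
- move=> e c s s1 s2 t1 t2 es _ IH1 _ IH2 v u vc su.
  have /[!geq_max]/andP[v0 v1] := vc.
  have [u1 [e1 su1 f1]] := IH1 _ _ v1 su.
  have [u2 [e2 su2 f2]] := IH2 _ _ vc su1.
  exists u2; split=> //; last by move=> j jv; rewrite f2 ?f1.
  by apply: exec_while_true e1 e2; rewrite -(eval_local v0 su).
- move=> e c s es v u; rewrite geq_max => /andP[v0 v1] su; exists u; split=> //.
  by apply: exec_while_false; rewrite -(eval_local v0 su).
Qed.

(** Writing a value costs at least its size, so no variable outgrows both its initial size and the
    elapsed time. This turns time bounds into bounds on the size of outputs. *)
Lemma exec_dsize c s t s' : exec c s t s' ->
  forall j, dsize (s' j) <= maxn (dsize (s j)) t.
Proof.
elim=> {c s t s'} /=.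
- by move=> s j; lia.
- by move=> i e s j; rewrite updateE; case: eqP => _; lia.
- by move=> c1 c2 s s1 s2 t1 t2 _ IH1 _ IH2 j; move: (IH1 j) (IH2 j); lia.
- by move=> e c1 c2 s s' t _ _ IH j; move: (IH j); lia.
- by move=> e c1 c2 s s' t _ _ IH j; move: (IH j); lia.
- by move=> e c s s1 s2 t1 t2 _ _ IH1 _ IH2 j; move: (IH1 j) (IH2 j); lia.
- by move=> e c s _ j; lia.
Qed.

(** * Polynomial bounds and composable programs *)

Definition poly_bounded (b : data -> nat) : Prop :=
  exists m, forall x, b x <= (dsize x).+1 ^ m.

Lemma poly_bounded_le a b :
  poly_bounded b -> (forall x, a x <= b x) -> poly_bounded a.
Proof. by case=> m bm ab; exists m => x; apply: leq_trans (bm x). Qed.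

Lemma leq_exp_base a b n : a <= b -> a ^ n <= b ^ n.
Proof. by case: n => // n ab; rewrite leq_exp2r. Qed.

(** The base [(dsize x).+1] is at least 2, so constants are absorbed by the exponent. *)
Lemma poly_bounded_cst n : poly_bounded (fun=> n).
Proof.
exists n => x; apply: leq_trans (ltnW (ltn_expl n (isT : 1 < 2))) _.
by apply: leq_exp_base; rewrite ltnS dsize_gt0.
Qed.

Lemma poly_bounded_dsize : poly_bounded dsize.
Proof. by exists 1 => x; rewrite expn1. Qed.

Lemma poly_boundedM a b :
  poly_bounded a -> poly_bounded b -> poly_bounded (fun x => a x * b x).
Proof.
by case=> m am [n bn]; exists (m + n) => x; rewrite expnD leq_mul.
Qed.

Lemma poly_boundedS a : poly_bounded a -> poly_bounded (fun x => (a x).+1).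
Proof.
case=> m am; exists m.+1 => x; rewrite expnS.
have := am x; have := dsize_gt0 x.
have : 0 < (dsize x).+1 ^ m by rewrite expn_gt0.
by nia.
Qed.

Lemma poly_boundedD a b :
  poly_bounded a -> poly_bounded b -> poly_bounded (fun x => a x + b x).
Proof.
move=> /poly_boundedS pa /poly_boundedS pb.
by apply: poly_bounded_le (poly_boundedM pa pb) _ => x; nia.
Qed.

Lemma poly_boundedX a n :
  poly_bounded a -> poly_bounded (fun x => a x ^ n).
Proof.
by case=> m am; exists (m * n) => x; rewrite expnM leq_exp_base.
Qed.

Lemma poly_bounded_comp b f :
  poly_bounded b -> poly_bounded (fun x => dsize (f x)) ->
  poly_bounded (fun x => b (f x)).
Proof.
case=> m bm pf.
exact: poly_bounded_le (poly_boundedX m (poly_boundedS pf)) _.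
Qed.

#[local] Hint Resolve poly_bounded_cst poly_bounded_dsize poly_boundedM
  poly_boundedS poly_boundedD poly_boundedX : core.

(* Unlike in [polytime], the initial store is arbitrary, and all variables above
   v are preserved, so such programs can be combined. *)
Definition computable (f : data -> data) : Prop :=
  exists (c : cmd) (v : nat) (T : data -> nat), poly_bounded T /\
    forall s, exists t s', [/\ exec c s t s', t <= T (s 0), s' 0 = f (s 0) &
                               forall j, v < j -> s' j = s j].

Lemma computable_polytime f : computable f -> polytime f.
Proof.
move=> [c [v [T [[m Tm] H]]]]; exists c, (2 * m + 2 ^ m) => x.
have [t [s' [e tT f0 _]]] := H (init_store x).
exists t, s'; split=> //; apply: leq_trans tT _; apply: leq_trans (Tm _) _ => /=.
(* For size at least 2, [(dsize x).+1] is at most the square of [dsize x]; for size 1 the bound is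
   the additive constant [2 ^ m]. *)
case: (ltnP 1 (dsize x)) => x1.
  apply: leq_trans (leq_addr _ _); apply: (@leq_trans (dsize x ^ (2 * m))).
    by rewrite expnM; apply: leq_exp_base; rewrite -mulnn; move: (dsize x) x1; nia.
  by rewrite leq_exp2l // leq_addr.
have -> : dsize x = 1 by have := dsize_gt0 x; lia.
by rewrite exp1n; lia.
Qed.

(** [polytime] only describes runs from [init_store], where all variables but 0 are [Nil]; clearing
    variables 1 to n recreates this, as far as the program can see, in any store. *)
Fixpoint clear (n : nat) : cmd :=
  if n is n'.+1 then CSeq (clear n') (CAssign n ENil) else CSkip.

Lemma exec_clear n s : exists s',
  exec (clear n) s (2 * n + 1) s' /\
  forall j, s' j = if 0 < j <= n then Nil else s j.
Proof.
elim: n => [|n [s' [e es]]] /=.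
  by exists s; split; [exact: exec_skip|case].
exists (update s' n.+1 Nil); split.
  rewrite (_ : 2 * n.+1 + 1 = 2 * n + 1 + (dsize (eval ENil s')).+1) /=; last by lia.
  by apply: exec_seq e _; exact: exec_assign.
move=> j; rewrite updateE es; case: eqP => [->|jn]; first by rewrite ltnSn.
by case: j jn => //= j jn; congr (if _ then _ else _); lia.
Qed.

Lemma polytime_computable f : polytime f -> computable f.
Proof.
move=> [c [m H]].
set v := cmd_bound c.
exists (CSeq (clear v) c), v, (fun x => 2 * v + 1 + (dsize x ^ m + m)).
split; first by auto 10.
move=> s; have [s1 [e1 es1]] := exec_clear v s.
have [t [s2 [e2 t2 f2]]] := H (s 0).
have agree j : j < v.+1 -> init_store (s 0) j = s1 j.
  by rewrite es1 /init_store updateE; case: j => //= j; rewrite ltnS => ->.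
have [u [eu fu gu]] := exec_frame e2 (leqnSn v) agree.
exists (2 * v + 1 + t), u; split=> //.
- exact: exec_seq e1 eu.
- by rewrite leq_add2l.
- by rewrite -fu.
- by move=> j vj; rewrite gu // es1 [j <= v]leqNgt vj andbF.
Qed.

Lemma computable_dsize f : computable f -> poly_bounded (fun x => dsize (f x)).
Proof.
move=> [c [v [T [pT H]]]].
apply: poly_bounded_le (poly_boundedD poly_bounded_dsize pT) _ => x.
have [t [s' [e tT <- _]]] := H (fun=> x).
by have := exec_dsize e 0; lia.
Qed.

Lemma computable_ext f g : f =1 g -> computable f -> computable g.
Proof. by move=> /funext->. Qed.

Lemma computable_expr e : expr_bound e <= 1 ->
  computable (fun x => eval e (fun=> x)).
Proof.
move=> e1; exists (CAssign 0 e), 0, (fun x => (dsize (eval e (fun=> x))).+1).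
split.
  apply: poly_boundedS; elim: e e1 => /= [i|_|a IHa b IHb|a IHa|a IHa].
  - by auto.
  - by auto.
  - by rewrite geq_max => /andP[/IHa pa /IHb pb]; auto.
  - by move=> /IHa pa; apply: poly_bounded_le pa _ => x; case: eval => //= u v; lia.
  - by move=> /IHa pa; apply: poly_bounded_le pa _ => x; case: eval => //= u v; lia.
move=> s; have -> : eval e (fun=> s 0) = eval e s.
  by apply: eval_local e1 _; case.
exists (dsize (eval e s)).+1, (update s 0 (eval e s)); split=> //.
  exact: exec_assign.
by case.
Qed.

(** * Closure under composition, pairing and branching *)

Lemma computable_id : computable (fun x => x).
Proof. exact: (@computable_expr (EVar 0)). Qed.

Lemma computable_nil : computable (fun=> Nil).
Proof. exact: (@computable_expr ENil). Qed.

Lemma computable_comp g f :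
  computable g -> computable f -> computable (fun x => g (f x)).
Proof.
move=> [cg [vg [Tg [pg Hg]]]] cf; have pf := computable_dsize cf.
case: cf => [c [v [T [pT H]]]].
exists (CSeq c cg), (maxn v vg), (fun x => T x + Tg (f x)); split.
  by apply: poly_boundedD => //; exact: poly_bounded_comp.
move=> s; have [t1 [s1 [e1 t1T f1 g1]]] := H s.
have [t2 [s2 [e2 t2T f2 g2]]] := Hg s1.
exists (t1 + t2), s2; split.
- exact: exec_seq e1 e2.
- by move: t2T; rewrite f1; lia.
- by rewrite f2 f1.
- by move=> j; rewrite gtn_max => /andP[vj vgj]; rewrite g2 // g1.
Qed.

Lemma computable_hd f : computable f -> computable (fun x => dhd (f x)).
Proof. exact/computable_comp/(@computable_expr (EHd (EVar 0))). Qed.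

Lemma computable_tl f : computable f -> computable (fun x => dtl (f x)).
Proof. exact/computable_comp/(@computable_expr (ETl (EVar 0))). Qed.

Lemma exec_assign_val i e s v : eval e s = v ->
  exec (CAssign i e) s (dsize v).+1 (update s i v).
Proof. by move=> <-; exact: exec_assign. Qed.

(** Evaluates [f] without losing the input: [v.+2] holds a copy of the input during the run, the
    result goes to [v.+1], and variable 0 is restored. A large [v] keeps the result out of reach of
    a second program. *)
Lemma computable_save f : computable f -> exists v0, forall v, v0 <= v ->
  exists (c : cmd) (T : data -> nat), poly_bounded T /\
    forall s, exists t s', [/\ exec c s t s', t <= T (s 0),
      s' 0 = s 0, s' v.+1 = f (s 0) & forall j, v.+2 < j -> s' j = s j].
Proof.
move=> cf; have pf := computable_dsize cf.
case: cf => [c [v0 [T [pT H]]]]; exists v0 => v v0v.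
exists (CSeq (CAssign v.+2 (EVar 0)) (CSeq c (CSeq (CAssign v.+1 (EVar 0))
         (CAssign 0 (EVar v.+2))))).
exists (fun x => (dsize x).+1 + (T x + ((dsize (f x)).+1 + (dsize x).+1))).
split; first by auto 10.
move=> s; set s1 := update s v.+2 (s 0).
have [t [s2 [e tT f2 g2]]] := H s1.
have s10 : s1 0 = s 0 by [].
exists ((dsize (s 0)).+1 + (t + ((dsize (f (s 0))).+1 + (dsize (s 0)).+1))).
exists (update (update s2 v.+1 (f (s 0))) 0 (s 0)); split.
- apply: exec_seq (exec_assign_val _ _) _; first by [].
  apply: exec_seq e _; apply: exec_seq (exec_assign_val _ _) _; first by rewrite /= f2.
  apply: exec_assign_val => /=; rewrite updateE gtn_eqF // g2 ?ltnS ?(leq_trans v0v) //.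
  by rewrite /s1 updateE eqxx.
- by rewrite s10 in tT; lia.
- by [].
- by rewrite !updateE eqxx.
- move=> j vj; rewrite !updateE !gtn_eqF ?g2 ?/s1 ?updateE ?gtn_eqF //; lia.
Qed.

Lemma computable_cons f g : computable f -> computable g ->
  computable (fun x => Cons (f x) (g x)).
Proof.
move=> cf cg; have pf := computable_dsize cf; have pg := computable_dsize cg.
have [v0 save_f] := computable_save cf.
case: cg => [cg [vg [Tg [pTg Hg]]]]; set v := maxn v0 vg.
have [c [T [pT H]]] := save_f v (leq_maxl _ _).
exists (CSeq c (CSeq cg (CAssign 0 (ECons (EVar v.+1) (EVar 0))))), v.+2.
exists (fun x => T x + (Tg x + (dsize (f x) + dsize (g x)).+2)); split; first by auto 10.
move=> s; have [t1 [s1 [e1 t1T s10 s1v g1]]] := H s.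
have [t2 [s2 [e2 t2T s20 g2]]] := Hg s1.
exists (t1 + (t2 + (dsize (Cons (f (s 0)) (g (s 0)))).+1)).
exists (update s2 0 (Cons (f (s 0)) (g (s 0)))); split=> //.
- apply: exec_seq e1 _; apply: exec_seq e2 _; apply: exec_assign_val => /=.
  by rewrite s20 s10 g2 ?ltnS ?leq_maxr // s1v.
- by rewrite s10 in t2T; rewrite /=; lia.
- by move=> j vj; rewrite updateE gtn_eqF ?g2 ?g1 //; lia.
Qed.

Lemma computable_cst d : computable (fun=> d).
Proof.
by elim: d => [|a IHa b IHb]; [exact: computable_nil|exact: computable_cons].
Qed.

Lemma computable_if f a b : computable f -> computable a -> computable b ->
  computable (fun x => if f x is Cons _ _ then a x else b x).
Proof.
move=> /computable_save[v0 save_f].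
move=> [ca [va [Ta [pTa Ha]]]] [cb [vb [Tb [pTb Hb]]]].
set v := maxn v0 (maxn va vb).
have [c [T [pT H]]] := save_f v (leq_maxl _ _).
exists (CSeq c (CIf (EVar v.+1) ca cb)), v.+2, (fun x => T x + (Ta x + Tb x).+1).
split; first by auto 10.
move=> s; have [t1 [s1 [e1 t1T s10 s1v g1]]] := H s.
case fs: (f (s 0)) => [|p q].
- have [t2 [s2 [e2 t2T s20 g2]]] := Hb s1.
  rewrite s10 in t2T s20.
  exists (t1 + t2.+1), s2; split=> //.
  + by apply: exec_seq e1 (exec_if_false _ _ e2); rewrite /= s1v.
  + by lia.
  + by move=> j vj; rewrite g2 ?g1 //; lia.
- have [t2 [s2 [e2 t2T s20 g2]]] := Ha s1.
  rewrite s10 in t2T s20.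
  exists (t1 + t2.+1), s2; split=> //.
  + by apply: exec_seq e1 (exec_if_true _ _ e2); rewrite /= s1v fs.
  + by lia.
  + by move=> j vj; rewrite g2 ?g1 //; lia.
Qed.

(** * Loops, folds and list operations *)

Fixpoint dlist (x : data) : seq data :=
  if x is Cons a b then a :: dlist b else [::].

Lemma enc_listK : cancel enc_list dlist.
Proof. by elim=> //= a s ->. Qed.

Lemma dlistK : cancel dlist enc_list.
Proof. by elim=> //= a _ b ->. Qed.

Lemma size_dlist x : size (dlist x) < dsize x.
Proof. by elim: x => //= a _ b IHb; have := dsize_gt0 a; lia. Qed.

(** The list [cnt x] is consumed as a loop counter. The polynomial bound on all intermediate values
    is essential: iterating a step that doubles its argument would build values of exponential
    size. *)
Lemma computable_iter f cnt a b :
  computable f -> computable cnt -> computable a -> poly_bounded b ->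
  (forall x i, i <= size (dlist (cnt x)) -> dsize (iter i f (a x)) <= b x) ->
  computable (fun x => iter (size (dlist (cnt x))) f (a x)).
Proof.
move=> [c [v0 [Tf [[m Tfm] H]]]] cc [ca [va [Ta [pTa Ha]]]] pb bP.
have pc := computable_dsize cc; have [v1 save_c] := computable_save cc.
set v := maxn v1 (maxn v0 va).
have [cs [Tc [pTc Hc]]] := save_c v (leq_maxl _ _).
pose body := CSeq c (CAssign v.+1 (ETl (EVar v.+1))).
have loop B x : forall s, s v.+1 = x ->
    (forall i, i <= size (dlist x) -> Tf (iter i f (s 0)) <= B) ->
    exists t s', [/\ exec (CWhile (EVar v.+1) body) s t s',
      t <= (dsize x * (B + dsize x + 2)).+1,
      s' 0 = iter (size (dlist x)) f (s 0) & forall j, v.+1 < j -> s' j = s j].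
  elim: x => [|p _ x IH] s sx Bs.
    by exists 1, s; split=> //; exact: exec_while_false.
  have [t1 [s1 [e1 t1T s10 g1]]] := H s.
  have s1v : s1 v.+1 = Cons p x by rewrite g1 //; lia.
  pose s2 := update s1 v.+1 x.
  have s20 : s2 0 = f (s 0) by [].
  have [|i|t3 [s3 [e3 t3T s30 g3]]] := IH s2.
  - by rewrite /s2 updateE eqxx.
  - by move=> i_le; rewrite s20 -iterSr; exact: Bs.
  exists (t1 + (dsize x).+1 + t3).+1, s3; split.
  - apply: exec_while_true e3; first by rewrite /= sx.
    by apply: exec_seq e1 (exec_assign_val _ _); rewrite /= s1v.
  - have := Bs 0 isT; rewrite /=; have := dsize_gt0 p; nia.
  - by rewrite s30 s20 -iterSr.
  - by move=> j vj; rewrite g3 // /s2 updateE gtn_eqF // g1 //; lia.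
exists (CSeq cs (CSeq ca (CWhile (EVar v.+1) body))), v.+2.
exists (fun x => Tc x + (Ta x +
  (dsize (cnt x) * ((b x).+1 ^ m + dsize (cnt x) + 2)).+1)); split; first by auto 12.
move=> s; have [t1 [s1 [e1 t1T s10 s1v g1]]] := Hc s.
have [t2 [s2 [e2 t2T s20 g2]]] := Ha s1; rewrite s10 in t2T s20.
have s2v : s2 v.+1 = cnt (s 0) by rewrite g2 //; lia.
have [|t3 [s3 [e3 t3T s30 g3]]] := loop ((b (s 0)).+1 ^ m) _ s2 s2v.
  move=> i ile; rewrite s20; apply: leq_trans (Tfm _) _; apply: leq_exp_base.
  exact: bP.
exists (t1 + (t2 + t3)), s3; split=> //.
- exact: exec_seq e1 (exec_seq e2 e3).
- by rewrite !leq_add.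
- by rewrite s30 s20.
- by move=> j vj; rewrite g3 ?g2 ?g1 //; lia.
Qed.

Lemma computable_app2 (F : data -> data -> data) a b :
  computable (fun x => F (dhd x) (dtl x)) -> computable a -> computable b ->
  computable (fun x => F (a x) (b x)).
Proof.
by move=> cF ca cb; exact: computable_comp cF (computable_cons ca cb).
Qed.

Lemma computable_app3 (F : data -> data -> data -> data) a b c :
  computable (fun x => F (dhd x) (dhd (dtl x)) (dtl (dtl x))) ->
  computable a -> computable b -> computable c ->
  computable (fun x => F (a x) (b x) (c x)).
Proof.
move=> cF ca cb cc.
exact: computable_comp cF (computable_cons ca (computable_cons cb cc)).
Qed.

Lemma dsize_nth_dlist l i : i < size (dlist l) -> dsize (nth Nil (dlist l) i) <= dsize l.
Proof.
elim: l i => //= a _ b IH [|i] /= il; first by lia.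
by have := IH i il; lia.
Qed.

(** The growth allowed per step depends on the parameter [e] and the element [v] but not on the
    accumulator, so it adds up over the list instead of compounding. *)
Lemma computable_foldl (F : data -> data -> data -> data) m e a l :
  computable (fun x => F (dhd x) (dhd (dtl x)) (dtl (dtl x))) ->
  (forall e a v, dsize (F e a v) <= dsize a + (dsize e + dsize v + 2) ^ m) ->
  computable e -> computable a -> computable l ->
  computable (fun x => foldl (F (e x)) (a x) (dlist (l x))).
Proof.
move=> cF Fm ce ca cl.
have pe := computable_dsize ce; have pa := computable_dsize ca.
have pl := computable_dsize cl.
(* The loop state holds the parameter, the accumulator and the unread part of the list. *)
pose step st := Cons (dhd st) (Cons (F (dhd st) (dhd (dtl st)) (dhd (dtl (dtl st))))
  (dtl (dtl (dtl st)))).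
have iterE i E A L : i <= size (dlist L) ->
    iter i step (Cons E (Cons A L)) =
    Cons E (Cons (foldl (F E) A (take i (dlist L))) (enc_list (drop i (dlist L)))).
  elim: i => [|i IH] iL; first by rewrite take0 drop0 dlistK.
  rewrite iterS IH ?(ltnW iL) // /step /=.
  rewrite (drop_nth Nil iL) /= (take_nth Nil iL) -cats1 foldl_cat /=.
  by rewrite -addn1 addnC -drop_drop (drop_nth Nil iL) /= drop0.
have foldl_le E A L i : i <= size (dlist L) ->
    dsize (foldl (F E) A (take i (dlist L))) <= dsize A + i * (dsize E + dsize L + 2) ^ m.
  elim: i => [|i IH] iL; first by rewrite take0 addn0.
  rewrite (take_nth Nil iL) -cats1 foldl_cat /=; apply: leq_trans (Fm _ _ _) _.
  have := IH (ltnW iL).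
  have : (dsize E + dsize (nth Nil (dlist L) i) + 2) ^ m <= (dsize E + dsize L + 2) ^ m.
    by apply: leq_exp_base; rewrite !leq_add2r leq_add2l dsize_nth_dlist.
  by rewrite mulSn; lia.
have dsize_drop L i : dsize (enc_list (drop i (dlist L))) <= dsize L.
  elim: L i => [//|p _ q IH] [|i] /=; first by rewrite dlistK.
  by have := IH i; lia.
have -> : (fun x => foldl (F (e x)) (a x) (dlist (l x))) =
    (fun x => dhd (dtl (iter (size (dlist (l x))) step (Cons (e x) (Cons (a x) (l x)))))).
  by apply: funext => x; rewrite iterE // take_size.
apply/computable_hd/computable_tl.
apply: (@computable_iter _ _ _ (fun x => (dsize (e x) + ((dsize (a x) +
   dsize (l x) * (dsize (e x) + dsize (l x) + 2) ^ m) + dsize (l x)).+1).+1)).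
- have cid := computable_id; rewrite /step.
  apply: computable_cons; first exact: computable_hd.
  apply: computable_cons; last by do !apply: computable_tl.
  apply: computable_app3 => //; first exact: computable_hd.
    exact/computable_hd/computable_tl.
  exact/computable_hd/computable_tl/computable_tl.
- by [].
- by do !apply: computable_cons.
- by auto 15.
- move=> x i ile; rewrite iterE //=.
  have := foldl_le (e x) (a x) (l x) i ile; have := dsize_drop (l x) i.
  have := size_dlist (l x).
  have : i * (dsize (e x) + dsize (l x) + 2) ^ m <=
    dsize (l x) * (dsize (e x) + dsize (l x) + 2) ^ m.
    by rewrite leq_mul2r (leq_trans ile) ?orbT // ltnW ?size_dlist.
  by lia.
Qed.

Lemma computable_rev l : computable l ->
  computable (fun x => enc_list (rev (dlist (l x)))).
Proof.
move=> cl; have cid := computable_id.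
apply: (@computable_ext (fun x => foldl ((fun _ a v => Cons v a) Nil) Nil (dlist (l x)))).
  have H A s : foldl (fun a v => Cons v a) A s = enc_list (catrev s (dlist A)).
    by elim: s A => [|v s IH] A /=; rewrite ?dlistK ?IH.
  by move=> x; exact: (H Nil).
apply: (@computable_foldl (fun _ a v => Cons v a) 1 (fun=> Nil)) => //; try exact: computable_cst.
  by apply: computable_cons; [do !apply: computable_tl|exact/computable_hd/computable_tl].
by move=> e a v /=; lia.
Qed.

Lemma computable_foldr (F : data -> data -> data -> data) m e a l :
  computable (fun x => F (dhd x) (dhd (dtl x)) (dtl (dtl x))) ->
  (forall e v a, dsize (F e v a) <= dsize a + (dsize e + dsize v + 2) ^ m) ->
  computable e -> computable a -> computable l ->
  computable (fun x => foldr (F (e x)) (a x) (dlist (l x))).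
Proof.
move=> cF Fm ce ca cl; have cid := computable_id.
apply: (@computable_ext (fun x => foldl ((fun e a v => F e v a) (e x)) (a x)
    (dlist (enc_list (rev (dlist (l x))))))).
  by move=> x; rewrite enc_listK foldl_rev.
apply: (@computable_foldl (fun e a v => F e v a) m) => //; last exact: computable_rev.
apply: (computable_app3 (F := F)) => //; first exact: computable_hd.
  by do !apply: computable_tl.
exact/computable_hd/computable_tl.
Qed.

Lemma computable_map (F : data -> data -> data) e l :
  computable (fun x => F (dhd x) (dtl x)) -> computable e -> computable l ->
  computable (fun x => enc_list [seq F (e x) v | v <- dlist (l x)]).
Proof.
move=> cF ce cl; have cid := computable_id.
have [m Fm] := computable_dsize cF.
apply: (@computable_ext (fun x => foldr ((fun e v a => Cons (F e v) a) (e x)) Nil (dlist (l x)))).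
  by move=> x; elim: (dlist _) => //= v s ->.
apply: (@computable_foldr (fun e v a => Cons (F e v) a) m.+1 e) => //; last exact: computable_cst.
  apply: computable_cons; last by do !apply: computable_tl.
  by apply: (computable_app2 (F := F)); [|exact: computable_hd|exact/computable_hd/computable_tl].
move=> E v A; have := Fm (Cons E v); rewrite /= expnS.
rewrite -[(_ + _).+2]addn2; have : 0 < (dsize E + dsize v + 2) ^ m by rewrite expn_gt0 addn2.
by move: (_ ^ m) (dsize_gt0 E) (dsize_gt0 v) => p; nia.
Qed.

Lemma computable_cat a b : computable a -> computable b ->
  computable (fun x => enc_list (dlist (a x) ++ dlist (b x))).
Proof.
move=> ca cb; have cid := computable_id.
apply: (@computable_ext (fun x => foldr ((fun _ v s => Cons v s) Nil) (b x) (dlist (a x)))).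
  by move=> x; elim: (dlist (a x)) => [|v s /= ->] //=; rewrite dlistK.
apply: (@computable_foldr (fun _ v s => Cons v s) 1 (fun=> Nil)) => //; last exact: computable_cst.
  by apply: computable_cons; [exact/computable_hd/computable_tl|do !apply: computable_tl].
by move=> e v s /=; lia.
Qed.

Lemma computable_flatten l : computable l ->
  computable (fun x => enc_list (flatten [seq dlist v | v <- dlist (l x)])).
Proof.
move=> cl; have cid := computable_id.
apply: (@computable_ext (fun x =>
    foldr ((fun _ v s => enc_list (dlist v ++ dlist s)) Nil) Nil (dlist (l x)))).
  by move=> x; elim: (dlist (l x)) => //= v s ->; rewrite enc_listK.
apply: (@computable_foldr (fun _ v s => enc_list (dlist v ++ dlist s)) 1 (fun=> Nil)) => //;
    try exact: computable_cst.
  apply: (@computable_cat (fun x => dhd (dtl x)) (fun x => dtl (dtl x))).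
    exact/computable_hd/computable_tl.
  by do !apply: computable_tl.
move=> e v s; rewrite expn1; elim: v => /= [|p _ q IH]; first by rewrite dlistK; lia.
by lia.
Qed.

(** The result always has the length of [a]; a shorter [b] is padded with [Nil], which reads as the
    bit 0. *)
Fixpoint zip_pad (a b : data) : data :=
  if a is Cons u a' then Cons (Cons u (dhd b)) (zip_pad a' (dtl b)) else Nil.

Lemma computable_zip_pad a b : computable a -> computable b ->
  computable (fun x => zip_pad (a x) (b x)).
Proof.
move=> ca cb; have cid := computable_id.
pose step (_ st v : data) :=
  Cons (Cons (Cons v (dhd (dtl st))) (dhd st)) (dtl (dtl st)).
apply: (@computable_ext (fun x =>
   enc_list (rev (dlist (dhd (foldl (step Nil) (Cons Nil (b x)) (dlist (a x)))))))).
  have H A u w : rev (dlist (dhd (foldl (step Nil) (Cons A w) (dlist u)))) =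
      rev (dlist A) ++ dlist (zip_pad u w).
    elim: u w A => [|p _ q IH] w A /=; first by rewrite cats0.
    by rewrite IH /= rev_cons cat_rcons.
  by move=> x; rewrite H /= dlistK.
apply: computable_rev; apply: computable_hd.
apply: (@computable_foldl step 2 (fun=> Nil)) => //.
- apply: computable_cons; [apply: computable_cons; [apply: computable_cons|]|].
  + by do !apply: computable_tl.
  + exact/computable_hd/computable_tl/computable_hd/computable_tl.
  + exact/computable_hd/computable_hd/computable_tl.
  + exact/computable_tl/computable_tl/computable_hd/computable_tl.
- move=> e st v; have : 2 * (dsize e + dsize v + 2) <= (dsize e + dsize v + 2) ^ 2.
    by rewrite -mulnn leq_mul2r leq_addl orbT.
  by have := dsize_gt0 e; rewrite /step; case: st => [|p [|q r]] /=; lia.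
- exact: computable_cst.
- by apply: computable_cons => //; exact: computable_cst.
Qed.

(** * Decidable predicates *)

Definition decidable_in_P (P : data -> bool) : Prop :=
  computable (fun x => enc_bool (P x)).

Lemma computable_ifb P a b : decidable_in_P P -> computable a -> computable b ->
  computable (fun x => if P x then a x else b x).
Proof.
move=> cP ca cb; apply: computable_ext (computable_if cP ca cb) => x.
by case: (P x).
Qed.

Definition truthy (x : data) : bool := if x is Cons _ _ then true else false.

Lemma decidable_truthy f : computable f -> decidable_in_P (fun x => truthy (f x)).
Proof.
move=> cf; apply: computable_ext (computable_if cf (computable_cst (Cons Nil Nil)) computable_nil).
by move=> x; case: (f x).
Qed.

Lemma decidable_negb P : decidable_in_P P -> decidable_in_P (fun x => ~~ P x).
Proof.
have ct := computable_cst (Cons Nil Nil).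
move=> cP; apply: computable_ext (computable_ifb cP (computable_cst Nil) ct).
by move=> x; case: (P x).
Qed.

Lemma decidable_andb P Q : decidable_in_P P -> decidable_in_P Q ->
  decidable_in_P (fun x => P x && Q x).
Proof.
move=> cP cQ; apply: computable_ext (computable_ifb cP cQ (computable_cst Nil)).
by move=> x; case: (P x).
Qed.

Lemma decidable_has (P : data -> data -> bool) e l :
  decidable_in_P (fun x => P (dhd x) (dtl x)) -> computable e -> computable l ->
  decidable_in_P (fun x => has (P (e x)) (dlist (l x))).
Proof.
move=> cP ce cl; have cid := computable_id; rewrite /decidable_in_P.
apply: (@computable_ext (fun x =>
   foldr ((fun e v a => if P e v then Cons Nil Nil else a) (e x)) Nil (dlist (l x)))).
  by move=> x; elim: (dlist (l x)) => //= v s ->; case: (P _ v).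
apply: (@computable_foldr (fun e v a => if P e v then Cons Nil Nil else a) 1 e) => //;
    try exact: computable_cst.
  apply: computable_ifb; [|exact: computable_cst|by do !apply: computable_tl].
  apply: (computable_app2 (F := fun x y => enc_bool (P x y))) => //.
    exact: computable_hd.
  exact/computable_hd/computable_tl.
by move=> E v A; case: ifP => /= _; have := dsize_gt0 A; lia.
Qed.

Lemma iter_dtl n x : iter n dtl x = enc_list (drop n (dlist x)).
Proof.
elim: n => [|n IH]; first by rewrite drop0 dlistK.
rewrite iterS IH -addn1 addnC -drop_drop.
by case: (drop n _) => //= v s; rewrite drop0.
Qed.

Lemma computable_drop c l : computable c -> computable l ->
  computable (fun x => enc_list (drop (size (dlist (c x))) (dlist (l x)))).
Proof.
move=> cc cl.
apply: (@computable_ext (fun x => iter (size (dlist (c x))) dtl (l x))).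
  by move=> x; rewrite iter_dtl.
apply: (@computable_iter _ _ _ (fun x => dsize (l x))) => //.
- exact/computable_tl/computable_id.
- exact: computable_dsize.
move=> x i _; elim: i => //= i IH; apply: leq_trans IH.
by case: (iter i dtl (l x)) => //= p q; lia.
Qed.

Lemma computable_drop_cst n l : computable l ->
  computable (fun x => enc_list (drop n (dlist (l x)))).
Proof.
move=> cl; have := computable_drop (computable_cst (enc_nat n)) cl.
by rewrite enc_listK size_nseq.
Qed.

Lemma decidable_size_leq a b : computable a -> computable b ->
  decidable_in_P (fun x => size (dlist (a x)) <= size (dlist (b x))).
Proof.
move=> ca cb.
apply: computable_ext (decidable_negb (decidable_truthy (computable_drop cb ca))) => x.
rewrite -subn_eq0 -size_drop; by case: (drop _ _).
Qed.

Lemma decidable_size_eq a b : computable a -> computable b ->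
  decidable_in_P (fun x => size (dlist (a x)) == size (dlist (b x))).
Proof.
move=> ca cb.
apply: computable_ext (decidable_andb (decidable_size_leq ca cb) (decidable_size_leq cb ca)).
by move=> x; rewrite eqn_leq.
Qed.

(** * The reduction *)

Lemma size_dlist_enc_nat n : size (dlist (enc_nat n)) = n.
Proof. by rewrite enc_listK size_nseq. Qed.

Lemma dsize_enc_nat n : dsize (enc_nat n) = n.*2.+1.
Proof. by elim: n => //= n; rewrite /enc_nat => ->; lia. Qed.

(* The state pairs a parity bit with the unary quotient. *)
Definition half_step (_ st _ : data) : data :=
  if truthy (dhd st) then Cons Nil (Cons Nil (dtl st)) else Cons (Cons Nil Nil) (dtl st).

Definition half_data (m : data) : data := dtl (foldl (half_step Nil) Nil (dlist m)).

Lemma half_dataE m : half_data m = enc_nat (size (dlist m))./2.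
Proof.
have H st : dtl (foldl (half_step Nil) st (dlist m)) =
    iter (size (dlist m) + truthy (dhd st))./2 (Cons Nil) (dtl st).
  elim: m st => [|p _ q IH] st /=; first by case: (truthy _).
  rewrite IH /half_step; case: (truthy (dhd st)); rewrite /= ?addn0 ?addn1 //.
  by rewrite -iterSr.
rewrite /half_data H addn0.
by elim: (_./2) => //= n ->.
Qed.

Lemma dsize_half_data m : dsize (half_data m) <= dsize m.
Proof. by rewrite half_dataE dsize_enc_nat; have := size_dlist m; lia. Qed.

Lemma computable_half_data a : computable a -> computable (fun x => half_data (a x)).
Proof.
move=> ca; apply: computable_tl; have cid := computable_id.
apply: (@computable_foldl half_step 2 (fun=> Nil)) => //; try exact: computable_cst.
  apply: computable_ifb.
  - exact/decidable_truthy/computable_hd/computable_hd/computable_tl.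
  - apply: computable_cons; first exact: computable_cst.
    apply: computable_cons; first exact: computable_cst.
    exact/computable_tl/computable_hd/computable_tl.
  - apply: computable_cons; first exact: computable_cst.
    exact/computable_tl/computable_hd/computable_tl.
move=> e st v; have : 2 * (dsize e + dsize v + 2) <= (dsize e + dsize v + 2) ^ 2.
  by rewrite -mulnn leq_mul2r leq_addl orbT.
by have := dsize_gt0 e; rewrite /half_step; case: st => [|[|p r] q] /=; lia.
Qed.

(** The state pairs the current unary number with the count of halvings. The test asks for at least
    two units, so the count ends at the floor of log2 and further iterations change nothing. *)
Definition log_step (st : data) : data :=
  if truthy (dtl (dhd st)) then Cons (half_data (dhd st)) (Cons Nil (dtl st)) else st.

Definition log_data (m : data) : data :=
  dtl (iter (size (dlist m)) log_step (Cons m Nil)).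

Lemma log_dataE m : log_data m = enc_nat (trunc_log 2 (size (dlist m))).
Proof.
have H n a c : size (dlist a) <= n -> dtl (iter n log_step (Cons a (enc_nat c))) =
    enc_nat (c + trunc_log 2 (size (dlist a))).
  elim: n a c => [|n IH] a c.
    by case: (dlist a) => //= _; rewrite trunc_log0 addn0.
  rewrite iterSr /log_step /=; case: ifP => a1 an.
    rewrite -[Cons Nil (enc_nat c)]/(enc_nat c.+1) IH half_dataE size_dlist_enc_nat; last by lia.
    rewrite (@trunc_log2S (size _)) ?addSnnS //.
    by case: a a1 {an} => //= _ [].
  have [an'|na] := ltnP (size (dlist a)) n.+1; first exact/IH.
  have a_le1 : size (dlist a) <= 1 by case: a a1 {IH an na} => //= _ [].
  have -> : size (dlist a) = 1 by lia.
  have -> /= : n = 0 by lia.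
  by rewrite trunc_log1 addn0.
by rewrite /log_data -[Cons m Nil]/(Cons m (enc_nat 0)) H.
Qed.

Lemma computable_log_data a : computable a -> computable (fun x => log_data (a x)).
Proof.
move=> ca; have cid := computable_id; apply: computable_tl.
apply: (@computable_iter _ _ _ (fun x => dsize (a x) + 2 + 2 * dsize (a x))) => //.
- apply: computable_ifb; last by [].
    exact/decidable_truthy/computable_tl/computable_hd.
  apply: computable_cons; first exact/computable_half_data/computable_hd.
  apply: computable_cons; first exact: computable_cst.
  exact: computable_tl.
- by apply: computable_cons => //; exact: computable_cst.
- by have pa := computable_dsize ca; auto 10.
move=> x i ile; have := size_dlist (a x).
have : dsize (iter i log_step (Cons (a x) Nil)) <= dsize (a x) + 2 + 2 * i.
  elim: i {ile} => /= [|i]; first by lia.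
  move: (iter i _ _) => [|p q]; rewrite /log_step /=; first by lia.
  by have := dsize_half_data p; case: ifP => _ /=; lia.
by lia.
Qed.

(** * Words of logarithmic length over a fixed alphabet *)

Fixpoint words (T : Type) (q : seq T) (l : nat) : seq (seq T) :=
  if l is l'.+1 then [seq c :: w | c <- q, w <- words q l'] else [:: [::]].

Definition word_step (O W : data) : data :=
  enc_list (flatten [seq dlist v | v <- dlist (enc_list
    [seq enc_list [seq enc_list (dlist o ++ dlist w) | w <- dlist W] | o <- dlist O])]).

Definition words_data (O L : data) : data :=
  iter (size (dlist L)) (word_step O) (Cons Nil Nil).

Lemma words_dataE (O : seq (seq data)) l :
  words_data (enc_list (map enc_list O)) (enc_nat l) =
  enc_list [seq enc_list (flatten w) | w <- words O l].
Proof.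
rewrite /words_data size_dlist_enc_nat; elim: l => //= l ->.
rewrite /word_step !enc_listK; congr enc_list.
rewrite -!map_comp map_flatten -map_comp; congr flatten; apply: eq_map => o /=.
by rewrite enc_listK -!map_comp; apply: eq_map => w /=; rewrite !enc_listK.
Qed.

Lemma dsize_enc_list s : dsize (enc_list s) = (\sum_(v <- s) (dsize v).+1).+1.
Proof. by elim: s => [|v s IH] /=; rewrite ?big_nil // big_cons IH addnS addSn. Qed.

Lemma dsize_dlist x : dsize x = (\sum_(v <- dlist x) (dsize v).+1).+1.
Proof. by rewrite -dsize_enc_list dlistK. Qed.

Lemma dsize_cat a b : dsize (enc_list (dlist a ++ dlist b)) < dsize a + dsize b.
Proof. by elim: a => [|p _ q IH] /=; rewrite ?dlistK //; lia. Qed.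

Lemma dsize_word_step O W : dsize (word_step O W) <= (dsize O) * dsize W.
Proof.
rewrite /word_step enc_listK dsize_enc_list -map_comp big_flatten big_map.
elim: O => [|o _ O IH] /=; first by rewrite big_nil mul1n dsize_gt0.
rewrite big_cons enc_listK big_map -addnS; apply: leq_trans (leq_add (leqnn _) IH) _.
rewrite mulSn mulnDl addnA leq_add2r (dsize_dlist W).
set s := dlist W; apply: (@leq_trans (\sum_(v <- s) (dsize o + (dsize v).+1))).
  elim: s => [|v s IHs]; rewrite ?big_nil // !big_cons leq_add //.
  by have := dsize_cat o v; lia.
elim: s => [|v s IHs]; rewrite ?big_nil // !big_cons; have := dsize_gt0 o; nia.
Qed.

(** Each round multiplies the size by at most the constant [dsize O], and there are only log2 n
    rounds, so the total factor is at most n to the power [dsize O]. This is polynomial because [O]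
    is fixed and not part of the input. *)
Lemma computable_words_data O a : computable a ->
  computable (fun x => words_data O (log_data (a x))).
Proof.
move=> ca; have cid := computable_id; have pa := computable_dsize ca.
apply: (@computable_iter _ _ _ (fun x => 3 * (dsize (a x)).+1 ^ dsize O)) => //.
- rewrite /word_step.
  pose catw := fun o w => enc_list (dlist o ++ dlist w).
  apply/computable_flatten.
  apply: (@computable_map (fun W o => enc_list [seq catw o w | w <- dlist W])) => //;
    last exact: computable_cst.
  apply: (@computable_map catw).
  + by apply: computable_cat; [exact: computable_hd|exact: computable_tl].
  + exact: computable_tl.
  + exact: computable_hd.
- exact: computable_log_data.
- exact: computable_cst.
- by auto 10.
move=> x i; rewrite log_dataE size_dlist_enc_nat => il.
apply: (@leq_trans (3 * dsize O ^ i)).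
  elim: i {il} => //= i IH; apply: leq_trans (dsize_word_step _ _) _.
  by rewrite expnS mulnCA leq_mul2l IH orbT.
rewrite leq_mul2l /=; apply: (@leq_trans ((2 ^ i) ^ dsize O)).
  by rewrite -expnM mulnC expnM leq_exp_base // ltnW // ltn_expl.
apply: leq_exp_base; apply: leq_trans (leq_pexp2l _ il) _ => //.
have := size_dlist (a x); case: (size _) => [|n] an; first by rewrite trunc_log0.
by apply: leq_trans (trunc_logP _ _) _ => //; lia.
Qed.

(** * Programs for the greedy code and for the points *)

Definition enc_bits (u : bitseq) : data := enc_list (map enc_bool u).

Lemma truthy_enc_bool b : truthy (enc_bool b) = b.
Proof. by case: b. Qed.

Definition dot (u v : bitseq) : nat := count (fun p => p.1 && p.2) (zip u v).

Definition drop_step (D : nat) (_ r p : data) : data :=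
  if truthy (dhd p) && truthy (dtl p) then iter D dtl r else r.

(* Each common 1 of w and v removes D units from the unary number r; started with
   l + 1 units, some are left iff D times the number of common ones is at most l. *)
Definition budget_data (D : nat) (r w v : data) : data :=
  foldl (drop_step D Nil) r (dlist (zip_pad w v)).

Lemma iter_dtl_enc_nat D k : iter D dtl (enc_nat k) = enc_nat (k - D).
Proof. by rewrite iter_dtl enc_listK drop_nseq. Qed.

Lemma budget_dataE D k u v :
  budget_data D (enc_nat k) (enc_bits u) (enc_bits v) = enc_nat (k - D * dot u v).
Proof.
rewrite /budget_data /dot.
elim: u v k => [|a u IH] [|b v] k /=.
- by rewrite muln0 subn0.
- by rewrite muln0 subn0.
- rewrite [drop_step D Nil _ _]/drop_step /= andbF /=; have := IH [::] k; rewrite -/(enc_bits u) /=.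
  by case: (u).
rewrite [drop_step D Nil _ _]/drop_step /= !truthy_enc_bool; case: (a && b) => /=; last exact: IH.
by rewrite iter_dtl_enc_nat IH; congr enc_nat; lia.
Qed.

Lemma computable_budget_data D r w v : computable r -> computable w -> computable v ->
  computable (fun x => budget_data D (r x) (w x) (v x)).
Proof.
move=> cr cw cv; have cid := computable_id.
apply: (@computable_foldl (drop_step D) 1 (fun=> Nil)) => //;
  [|move=> e a p|exact: computable_cst|exact: computable_zip_pad].
- apply: computable_ifb; last exact/computable_hd/computable_tl.
    by apply: decidable_andb; apply: decidable_truthy;
       [apply: computable_hd|]; do !apply: computable_tl.
  apply: computable_ext (computable_drop_cst D (computable_hd (computable_tl cid))) => x.
  by rewrite iter_dtl.
- rewrite /drop_step; case: ifP => _; last by lia.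
  apply: leq_trans (leq_addr _ _); elim: D => //= D; apply: leq_trans.
  by case: (iter D dtl a) => //= s t; lia.
Qed.

(** An exhausted budget signals a conflict: with [r] equal to l + 1, the word [w] is dropped iff D
    times its overlap with some kept word exceeds l. *)
Definition greedy_step (D : nat) (r acc w : data) : data :=
  if has (fun v => ~~ truthy (budget_data D r w v)) (dlist acc) then acc else Cons w acc.

Definition greedy_data (D : nat) (r W : data) : data :=
  foldl (greedy_step D r) Nil (dlist W).

Lemma computable_greedy_data D r W : computable r -> computable W ->
  computable (fun x => greedy_data D (r x) (W x)).
Proof.
move=> cr cW; have cid := computable_id.
apply: (@computable_foldl (greedy_step D) 1) => //; last exact: computable_cst.
  apply: computable_ifb.
  - apply: (@decidable_has (fun e v => ~~ truthy (budget_data D (dhd e) (dtl e) v))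
      (fun x => Cons (dhd x) (dtl (dtl x)))).
    + apply/decidable_negb/decidable_truthy/computable_budget_data.
      * exact/computable_hd/computable_hd.
      * exact/computable_tl/computable_hd.
      * exact/computable_tl.
    + by apply: computable_cons; [exact: computable_hd|do !apply: computable_tl].
    + exact/computable_hd/computable_tl.
  - exact/computable_hd/computable_tl.
  - by apply: computable_cons; [do !apply: computable_tl|exact/computable_hd/computable_tl].
by move=> e a v; rewrite /greedy_step; case: ifP => _ /=; lia.
Qed.

(** The state is a found flag and the unread part of the list of codewords. Raising the flag freezes
    the state, and the unread part then starts with the answer. Unary numbers are compared by
    length. *)
Definition lookup_step (i st v : data) : data :=
  if truthy (dhd st) then st
  else if size (dlist v) == size (dlist i) then Cons (Cons Nil Nil) (dtl st)
  else Cons Nil (dtl (dtl st)).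

Definition lookup_data (i V C : data) : data :=
  dhd (dtl (foldl (lookup_step i) (Cons Nil C) (dlist V))).

Lemma lookup_dataE i (vs : seq nat) C : i \in vs ->
  lookup_data (enc_nat i) (enc_list (map enc_nat vs)) (enc_list C) = nth Nil C (index i vs).
Proof.
rewrite /lookup_data enc_listK.
have found st us : truthy (dhd st) ->
    foldl (lookup_step (enc_nat i)) st us = st.
  by move=> tst; elim: us => //= v us IH; rewrite [lookup_step _ st _]/lookup_step tst.
elim: vs C => //= v vs IH C; rewrite inE [lookup_step _ _ _]/lookup_step /=.
rewrite !size_dlist_enc_nat eq_sym; case: eqP => /= [_|_ ivs].
  by rewrite found //; case: C.
rewrite -[dtl (enc_list C)]/(iter 1 dtl (enc_list C)) iter_dtl enc_listK drop1 IH //.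
by rewrite nth_behead.
Qed.

Lemma computable_lookup_data i V C : computable i -> computable V -> computable C ->
  computable (fun x => lookup_data (i x) (V x) (C x)).
Proof.
move=> ci cV cC; have cid := computable_id; apply/computable_hd/computable_tl.
apply: (@computable_foldl lookup_step 2) => //; last first.
- by apply: computable_cons => //; exact: computable_cst.
- move=> e st v; have : 2 * (dsize e + dsize v + 2) <= (dsize e + dsize v + 2) ^ 2.
    by rewrite -mulnn leq_mul2r leq_addl orbT.
  have := dsize_gt0 e; rewrite /lookup_step; case: ifP => _; first by lia.
  by case: ifP => _; case: st => [|p [|s t]] /=; lia.
have cst := computable_hd (computable_tl cid).
apply: computable_ifb => //; first exact/decidable_truthy/computable_hd.
apply: computable_ifb.
- by apply: decidable_size_eq; [do !apply: computable_tl|exact: computable_hd].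
- by apply: computable_cons; [exact: computable_cst|exact: computable_tl].
- by apply: computable_cons; [exact: computable_cst|exact/computable_tl/computable_tl].
Qed.

Definition or_pair (_ p : data) : data := if truthy (dhd p) then dhd p else dtl p.

Definition or_data (a b : data) : data :=
  enc_list [seq or_pair Nil p | p <- dlist (zip_pad a b)].

Definition bit_or (u v : bitseq) : bitseq := [seq p.1 || p.2 | p <- zip u v].

Lemma or_dataE u v : size u = size v ->
  or_data (enc_bits u) (enc_bits v) = enc_bits (bit_or u v).
Proof.
rewrite /or_data /enc_bits /bit_or.
elim: u v => [|a u IH] [|b v] //= [uv]; rewrite IH // /or_pair /= truthy_enc_bool.
by case: a.
Qed.

Lemma dsize_or_data a b : dsize (or_data a b) <= dsize a + dsize b.
Proof.
rewrite /or_data; elim: a b => [|p _ q IH] b /=; first by lia.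
by have := dsize_gt0 p; have := IH (dtl b); rewrite /or_pair /=; case: ifP; case: b => //= s t; lia.
Qed.

Lemma computable_or_data a b : computable a -> computable b ->
  computable (fun x => or_data (a x) (b x)).
Proof.
move=> ca cb; have cid := computable_id.
apply: (@computable_map or_pair (fun=> Nil)); [|exact: computable_cst|exact: computable_zip_pad].
by apply: computable_ifb; do ?apply: decidable_truthy; do ?apply: computable_hd;
  do ?apply: computable_tl.
Qed.

Definition point_data (V C T : data) : data :=
  foldl (fun acc i => or_data acc (lookup_data i V C))
    (enc_list [seq Nil | _ <- dlist (dhd C)]) (dlist T).

Lemma computable_point_data V C T : computable V -> computable C -> computable T ->
  computable (fun x => point_data (V x) (C x) (T x)).
Proof.
move=> cV cC cT; have cid := computable_id.
have cl : computable (fun x => lookup_data (dtl x) (dhd (dhd x)) (dtl (dhd x))).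
  apply: computable_lookup_data; [exact: computable_tl|exact/computable_hd/computable_hd|].
  exact/computable_tl/computable_hd.
have [m lm] := computable_dsize cl.
apply: (@computable_foldl (fun e acc i => or_data acc (lookup_data i (dhd e) (dtl e))) m
   (fun x => Cons (V x) (C x))) => //.
- apply: computable_or_data; first exact/computable_hd/computable_tl.
  apply: computable_lookup_data; [by do !apply: computable_tl|exact/computable_hd/computable_hd|].
  exact/computable_tl/computable_hd.
- move=> e a i; apply: leq_trans (dsize_or_data _ _) _; rewrite leq_add2l.
  by have := lm (Cons e i); rewrite /= -[(_ + _).+2]addn2.
- exact: computable_cons.
- apply: (@computable_map (fun _ _ => Nil) (fun=> Nil)); try exact: computable_cst.
  exact: computable_hd.
Qed.

(** Only the length of the list [E] enters, through its logarithm l; the budget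
    [Cons Nil (log_data E)] is l + 1 in unary. *)
Definition code_data (D : nat) (O E : data) : data :=
  greedy_data D (Cons Nil (log_data E)) (words_data O (log_data E)).

Definition flatten_data (E : data) : data :=
  enc_list (flatten [seq dlist v | v <- dlist E]).

(** A vertex receives the codeword at the position of its first occurrence in the concatenation of
    all sets, so z |E| codewords suffice, whatever N is. *)
Definition reduction (D : nat) (O x : data) : data :=
  Cons (enc_list [seq point_data (flatten_data (dhd (dtl x)))
                        (code_data D O (dhd (dtl x))) T | T <- dlist (dhd (dtl x))])
       (dtl (dtl x)).

Lemma computable_reduction D O : computable (reduction D O).
Proof.
have cid := computable_id; have cE := computable_hd (computable_tl cid).
apply: computable_cons; last by do !apply: computable_tl.
apply: (@computable_map (fun e T => point_data (flatten_data e) (code_data D O e) T)) => //.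
have ce := computable_hd cid.
apply: computable_point_data; [exact: computable_flatten| |exact: computable_tl].
apply: computable_greedy_data; last exact: computable_words_data.
by apply: computable_cons; [exact: computable_cst|exact: computable_log_data].
Qed.

(** * Combinatorics of the greedy code *)

Definition onehot (q c : nat) : bitseq := [seq c == j | j <- iota 0 q].

Definition bits (q : nat) (w : seq nat) : bitseq := flatten [seq onehot q c | c <- w].

Definition agree (u v : seq nat) : nat := count (fun p => p.1 == p.2) (zip u v).

Definition greedy (D l : nat) (ws : seq (seq nat)) : seq (seq nat) :=
  foldl (fun acc w => if has (fun v => l < D * agree w v) acc then acc else w :: acc)
    [::] ws.

Lemma words_map (T U : Type) (f : T -> U) s l :
  words (map f s) l = map (map f) (words s l).
Proof.
elim: l => //= l IH; rewrite IH map_flatten -!map_comp; congr flatten.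
by apply: eq_map => c /=; rewrite -!map_comp.
Qed.

Lemma mem_words q l w : w \in words (iota 0 q) l -> size w = l /\ all (fun c => c < q) w.
Proof.
elim: l w => [|l IH] w /=; first by rewrite inE => /eqP->.
case/allpairsP => -[c v] /= [+ /IH[sv vq] ->]; rewrite mem_iota add0n /= => cq.
by rewrite /= sv cq.
Qed.

Lemma size_words (T : Type) (s : seq T) l : size (words s l) = size s ^ l.
Proof. by elim: l => //= l IH; rewrite size_allpairs IH expnS. Qed.

Lemma size_bits q w : size (bits q w) = size w * q.
Proof.
elim: w => //= c w IH; rewrite /bits /= size_cat size_map size_iota mulSn.
by rewrite -IH.
Qed.

Lemma dot_cat u v u' v' : size u = size v -> dot (u ++ u') (v ++ v') = dot u v + dot u' v'.
Proof. by move=> uv; rewrite /dot zip_cat // count_cat. Qed.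

Lemma dot_onehot q c c' : c < q -> dot (onehot q c) (onehot q c') = (c == c').
Proof.
move=> cq; rewrite /dot /onehot zip_map count_map.
rewrite (@eq_count _ _ (fun j => (j == c) && (j == c'))); last first.
  by move=> j /=; rewrite !(eq_sym j).
have [<-|cc'] := eqVneq c c'.
  rewrite (@eq_count _ _ (pred1 c)) => [|j]; last by rewrite /= andbb.
  by rewrite (count_uniq_mem _ (iota_uniq 0 q)) mem_iota add0n cq.
rewrite (@eq_count _ _ pred0) ?count_pred0 // => j /=; apply/negbTE.
by apply: contraNN cc' => /andP[/eqP-> /eqP->].
Qed.

Lemma dot_bits q u v : size u = size v -> all (fun c => c < q) u ->
  dot (bits q u) (bits q v) = agree u v.
Proof.
elim: u v => [|c u IH] [|c' v] //= [uv] /andP[cq uq].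
rewrite dot_cat ?size_map ?size_iota // dot_onehot //.
by rewrite -/(bits q u) -/(bits q v) IH.
Qed.

Lemma agreeC u v : agree u v = agree v u.
Proof. by elim: u v => [|c u IH] [|c' v] //; rewrite /agree /= -/(agree u v) IH eq_sym. Qed.

Lemma agreexx u : agree u u = size u.
Proof. by elim: u => //= c u IH; rewrite /agree /= eqxx -/(agree u u) IH. Qed.

(* The moment generating function of the number of agreements with v. *)
Lemma sum_words_agree q l v :
  \sum_(w <- words (iota 0 q) l) q ^ agree w v <= (2 * q) ^ l.
Proof.
elim: l v => [|l IH] v; first by rewrite big_seq1 /agree; case: v.
rewrite [words _ _.+1]/= big_allpairs_dep /=; case: v => [|c v].
  rewrite (eq_bigr (fun=> q ^ l)) => [|a _].
    rewrite big_const_seq count_predT size_iota iter_addn_0 -expnSr.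
    exact/leq_exp_base/leq_pmull.
  rewrite (eq_bigr (fun=> 1)) ?sum1_size ?size_words ?size_iota // => w _.
rewrite (eq_bigr (fun a => q ^ (a == c) * \sum_(w <- words (iota 0 q) l) q ^ agree w v));
  last by move=> a _; rewrite big_distrr /=; apply: eq_bigr => w _; rewrite -expnD.
rewrite -big_distrl /= expnS; apply: leq_mul (IH v).
(* The first letter contributes a factor q if it equals [c] and 1 otherwise, in total at most 2q. *)
apply: (@leq_trans (\sum_(a <- iota 0 q) (1 + (a == c) * q))).
  by apply: leq_sum => a _; case: (a == c); rewrite ?expn1 ?expn0; lia.
rewrite big_split /= sum1_size size_iota mul2n -addnn leq_add2l -big_distrl /=.
rewrite -[leqRHS]mul1n leq_mul2r; apply/orP; right.
rewrite (_ : \sum_(a <- _) _ = count_mem c (iota 0 q)).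
  by rewrite (count_uniq_mem _ (iota_uniq 0 q)) leq_b1.
by rewrite -sum1_count [RHS]big_mkcond; apply: eq_bigr => a _ /=; case: eqP.
Qed.

Lemma greedy_catE D l ws w :
  greedy D l (rcons ws w) =
  if has (fun v => l < D * agree w v) (greedy D l ws) then greedy D l ws
  else w :: greedy D l ws.
Proof. by rewrite /greedy -cats1 foldl_cat. Qed.

Lemma mem_greedy D l ws : {subset greedy D l ws <= ws}.
Proof.
elim/last_ind: ws => // ws w IH v; rewrite greedy_catE mem_rcons inE.
case: ifP => _; last by rewrite inE => /orP[->//|/IH->]; rewrite orbT.
by move=> /IH->; rewrite orbT.
Qed.

Lemma greedy_pairwise D l ws :
  pairwise (fun u v => D * agree u v <= l) (greedy D l ws).
Proof.
elim/last_ind: ws => // ws w IH; rewrite greedy_catE; case: ifPn => //= wG.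
rewrite IH andbT -all_predC in wG *.
by apply: sub_all wG => v /=; rewrite -leqNgt.
Qed.

(** The code is maximal: a dropped word conflicts with a kept one, and a kept word conflicts with
    itself, as it agrees with itself in all l positions. *)
Lemma greedy_cover D l ws w : (forall v, v \in ws -> size v = l) -> l < D * l ->
  w \in ws -> has (fun v => l < D * agree w v) (greedy D l ws).
Proof.
move=> + lD; elim/last_ind: ws => // ws v IH sz; rewrite greedy_catE mem_rcons inE.
have {}IH : w \in ws -> has (fun v => l < D * agree w v) (greedy D l ws).
  by apply: IH => u uws; apply: sz; rewrite mem_rcons inE uws orbT.
case/orP => [/eqP->|/IH wG]; last by case: ifP => //= _; rewrite wG orbT.
case: ifPn => //= _; rewrite agreexx sz ?lD //.
by rewrite mem_rcons inE eqxx.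
Qed.

(* Chernoff bound: every word w has more than l / D agreements with some greedy
   word v, and then q ^ agree w v > 16 ^ l. *)
Lemma size_greedy D l : 1 < D -> 0 < l ->
  8 ^ l <= size (greedy D l (words (iota 0 (16 ^ D)) l)).
Proof.
move=> D1 l0; set q := 16 ^ D; set ws := words _ l; set G := greedy D l ws.
have q0 : 0 < q by rewrite expn_gt0.
have lD : l < D * l by rewrite ltn_Pmull.
have sz v : v \in ws -> size v = l by case/mem_words.
(* Double counting: each of the q ^ l words has a conflicting kept word, whose term alone is at
   least 16 ^ l because q is 16 ^ D. *)
have lower : q ^ l * 16 ^ l <= \sum_(w <- ws) \sum_(v <- G) q ^ agree w v.
  have <- : size ws = q ^ l by rewrite size_words size_iota.
  rewrite -sum1_size big_distrl /= big_seq [leqRHS]big_seq; apply: leq_sum => w ww.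
  rewrite mul1n; have /hasP[v vG lv] := greedy_cover sz lD ww.
  rewrite (big_rem v vG) /=; apply: leq_trans (leq_addr _ _).
  by rewrite /q -expnM leq_exp2l // ltnW.
have upper : \sum_(w <- ws) \sum_(v <- G) q ^ agree w v <= size G * (2 * q) ^ l.
  rewrite exchange_big /= -sum1_size big_distrl /=; apply: leq_sum => v _.
  by rewrite mul1n sum_words_agree.
have := leq_trans lower upper.
(* Splitting 16 as 2 times 8 lets (2q) ^ l cancel, which leaves 8 ^ l. *)
rewrite (_ : 16 = 2 * 8) // !expnMn mulnCA mulnA [leqRHS]mulnC.
by rewrite leq_pmul2l // muln_gt0 !expn_gt0.
Qed.

(** * The instance produced by the reduction *)

Definition letters_data (q : nat) : data :=
  enc_list [seq enc_bits (onehot q c) | c <- iota 0 q].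

Lemma truthy_enc_nat n : truthy (enc_nat n) = (0 < n).
Proof. by case: n. Qed.

Lemma enc_bits_flatten q w :
  enc_list (flatten [seq map enc_bool (onehot q c) | c <- w]) = enc_bits (bits q w).
Proof. by rewrite /enc_bits /bits map_flatten -map_comp. Qed.

(** The common ones of two one-hot images are the agreements of the words, so the budget test on bit
    vectors is the greedy test on words. *)
Lemma code_dataE D q m (l := trunc_log 2 (size (dlist m))) :
  code_data D (letters_data q) m =
  enc_list [seq enc_bits (bits q w) | w <- greedy D l (words (iota 0 q) l)].
Proof.
rewrite /code_data log_dataE -/l.
rewrite /letters_data (eq_map (g := enc_list \o (fun c => map enc_bool (onehot q c)))) //.
rewrite map_comp words_dataE words_map -map_comp.
rewrite (eq_map (g := fun w => enc_bits (bits q w))); last first.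
  by move=> w /=; rewrite enc_bits_flatten.
rewrite -[Cons Nil (enc_nat l)]/(enc_nat l.+1) /greedy_data enc_listK.
have := @mem_words q l; move: (words _ l) => ws.
elim/last_ind: ws => // ws w IH wsP; rewrite map_rcons -cats1 foldl_cat /= greedy_catE.
rewrite {}IH => [|v vws]; last by apply: wsP; rewrite mem_rcons inE vws orbT.
have [sw wq] : size w = l /\ all (fun c => c < q) w.
  by apply: wsP; rewrite mem_rcons inE eqxx.
rewrite /greedy_step enc_listK has_map.
rewrite (@eq_in_has _ _ (fun v => l < D * agree w v)); first by case: ifP.
move=> v /mem_greedy vws /=; rewrite budget_dataE truthy_enc_nat.
have [sv _] : size v = l /\ all (fun c => c < q) v.
  by apply: wsP; rewrite mem_rcons inE vws orbT.
by rewrite dot_bits ?sw ?sv // subn_gt0 ltnS -ltnNge.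
Qed.

Definition union_point (N d : nat) (B : 'I_N -> {set 'I_d}) (T : {set 'I_N}) :
    d.-tuple bool :=
  [tuple p \in \bigcup_(i in T) B i | p < d].

(** Vertices in no member of [E] may have an empty block, hence size exactly l is required only
    inside members. Two blocks overlap in at most a fraction 1/D of l. *)
Definition nearly_disjoint (D l N d : nat) (E : {set {set 'I_N}})
    (B : 'I_N -> {set 'I_d}) : Prop :=
  [/\ forall i, #|B i| <= l,
      forall T i, T \in E -> i \in T -> #|B i| = l &
      forall i j, i != j -> D * #|B i :&: B j| <= l].

Lemma card_bits_set d (u : bitseq) : size u = d ->
  #|[set p : 'I_d | nth false u p]| = count id u.
Proof.
move=> <-; rewrite cardsE -sum1_card -sum1_count (big_nth false) big_mkord.
by apply: eq_bigl.
Qed.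

Lemma card_bits_setI d (u v : bitseq) : size u = d -> size v = d ->
  #|[set p : 'I_d | nth false u p] :&: [set p : 'I_d | nth false v p]| = dot u v.
Proof.
move=> su sv; pose w := [seq p.1 && p.2 | p <- zip u v].
have -> : dot u v = count id w by rewrite /dot count_map.
rewrite -(@card_bits_set d) ?size_map ?size_zip ?su ?sv ?minnn //.
congr #|pred_of_set _|; apply/setP => p; rewrite !inE.
by rewrite (nth_map (false, false)) ?size_zip ?su ?sv ?minnn // nth_zip ?su ?sv.
Qed.

Lemma count_bits q w : all (fun c => c < q) w -> count id (bits q w) = size w.
Proof.
move=> wq; rewrite -agreexx -(@dot_bits q w w) // /dot.
by elim: (bits q w) => //= b u ->; rewrite andbb.
Qed.

Lemma nth_foldl_bit_or d (u : bitseq) us p : size u = d ->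
  all (fun v => size v == d) us -> p < d ->
  size (foldl bit_or u us) = d /\
  nth false (foldl bit_or u us) p = nth false u p || has (fun v => nth false v p) us.
Proof.
move=> + + pd; elim: us u => [|v us IH] u /= su; first by rewrite orbF.
case/andP => /eqP sv /(IH (bit_or u v))[].
  by rewrite size_map size_zip su sv minnn.
move=> -> ->; split=> //; rewrite orbA; congr orb.
by rewrite (nth_map (false, false)) ?size_zip ?su ?sv ?minnn // nth_zip ?su ?sv.
Qed.

(** The greedy code has at least 8 ^ l words, so z |E| <= 8 ^ l leaves a codeword for every position
    in the list of vertices. *)
Lemma reductionE D z N (E : {set {set 'I_N}}) k x
    (l := trunc_log 2 #|E|) (q := 16 ^ D) :
  1 < D -> 0 < l -> (forall T, T \in E -> #|T| = z) -> z * #|E| <= 8 ^ l ->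
  encodes_johnson E k x ->
  exists B : 'I_N -> {set 'I_(l * q)}, nearly_disjoint D l E B /\
  exists2 s : seq {set 'I_N}, perm_eq s (enum E) &
    reduction D (letters_data q) x =
    Cons (enc_list [seq enc_point (union_point B T) | T <- s]) (enc_nat k).
Proof.
move=> D1 l0 Ez El [s sE ->].
have size_s : size s = #|E| by rewrite (perm_size sE) -cardE.
have mem_s T : (T \in s) = (T \in E) by rewrite (perm_mem sE) mem_enum.
pose elts (T : {set 'I_N}) := [seq val i | i <- enum T].
pose vs := flatten (map elts s).
have size_vs : size vs = z * #|E|.
  rewrite -size_s /vs; have : all (fun T : {set 'I_N} => #|T| == z) s.
    by apply/allP => T; rewrite mem_s => /Ez->.
  elim: (s) => [|T t IH] /=; first by rewrite muln0.
  by case/andP=> /eqP Tz /IH; rewrite size_cat size_map -cardE Tz mulnS => ->.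
have mem_vs T i : T \in E -> i \in T -> val i \in vs.
  move=> TE iT; apply/flattenP; exists (elts T); first by rewrite map_f ?mem_s.
  by rewrite map_f ?mem_enum.
set G := greedy D l (words (iota 0 q) l).
have vsG : size vs <= size G by rewrite size_vs (leq_trans El) ?size_greedy.
pose W (i : nat) := nth [::] G (index i vs).
have WG i : i \in vs -> W i \in G by move=> ivs; rewrite mem_nth // (leq_trans _ vsG) ?index_mem.
have GP w : w \in G -> size w = l /\ all (fun c => c < q) w by move=> /mem_greedy/mem_words.
pose B (i : 'I_N) : {set 'I_(l * q)} :=
  if val i \in vs then [set p : 'I_(l * q) | nth false (bits q (W i)) p] else finset.set0.
have size_bitsG w : w \in G -> size (bits q w) = l * q.
  by move=> /GP[sw _]; rewrite size_bits sw.
have BE i : val i \in vs -> B i = [set p : 'I_(l * q) | nth false (bits q (W i)) p].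
  by rewrite /B => ->.
have cardB i : val i \in vs -> #|B i| = l.
  move=> ivs; rewrite BE // card_bits_set ?size_bitsG ?WG //.
  by have [sW Wq] := GP _ (WG _ ivs); rewrite count_bits.
exists B; split.
  split=> [i|T i TE iT|i j ij].
  - by have [/cardB->//|ivs] := boolP (val i \in vs); rewrite /B (negbTE ivs) cards0.
  - by rewrite cardB // (mem_vs T).
  have [ivs|ivs] := boolP (val i \in vs); last by rewrite /B (negbTE ivs) set0I cards0 muln0.
  have [jvs|jvs] := boolP (val j \in vs); last by rewrite /B (negbTE jvs) setI0 cards0 muln0.
  have [sWi Wiq] := GP _ (WG _ ivs); have [sWj Wjq] := GP _ (WG _ jvs).
  rewrite !BE // card_bits_setI ?size_bitsG ?WG // dot_bits ?sWi //.
  have idx_neq : index (val i) vs != index (val j) vs.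
    by apply: contra_neq ij => /(index_inj 0 ivs jvs); exact: val_inj.
  have /pairwiseP-/(_ [::]) pw := greedy_pairwise D l (words (iota 0 q) l).
  have lt_i : index (val i) vs < size G by rewrite (leq_trans _ vsG) ?index_mem.
  have lt_j : index (val j) vs < size G by rewrite (leq_trans _ vsG) ?index_mem.
  case: (ltngtP (index (val i) vs) (index (val j) vs)) idx_neq => // ltij _; first exact: pw.
  by rewrite agreeC; exact: pw.
exists s => //; rewrite /reduction /=; congr Cons; rewrite enc_listK -map_comp; congr enc_list.
have -> : flatten_data (enc_list [seq enc_subset T | T <- s]) = enc_list (map enc_nat vs).
  rewrite /flatten_data enc_listK /vs map_flatten -!map_comp; congr (enc_list (flatten _)).
  by apply: eq_map => T /=; rewrite /enc_subset enc_listK -map_comp.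
have -> : code_data D (letters_data q) (enc_list [seq enc_subset T | T <- s]) =
    enc_list [seq enc_bits (bits q w) | w <- G].
  by rewrite code_dataE enc_listK size_map size_s.
apply/eq_in_map => T; rewrite mem_s => TE /=.
rewrite /point_data /enc_subset enc_listK.
have [w [G' Gw]] : exists w G', G = w :: G'.
  have : 0 < size G by rewrite (leq_trans _ (size_greedy D1 l0)) ?expn_gt0.
  by case: (G) => // w G' _; exists w, G'.
have -> : enc_list [seq Nil | _ <- dlist (dhd (enc_list [seq enc_bits (bits q w) | w <- G]))] =
    enc_bits (nseq (l * q) false).
  rewrite Gw /= /enc_bits enc_listK -map_comp -(size_bitsG w) ?Gw ?mem_head //.
  by congr enc_list; elim: (bits q w) => //= b u ->.
have us_in : all (fun i => i \in vs) (elts T).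
  by apply/allP => i /mapP[j]; rewrite mem_enum => jT ->; exact: mem_vs TE jT.
have foldE u : size u = l * q -> foldl (fun acc i => or_data acc
      (lookup_data i (enc_list (map enc_nat vs)) (enc_list [seq enc_bits (bits q w) | w <- G])))
      (enc_bits u) [seq enc_nat i | i : 'I_N <- enum T] =
    enc_bits (foldl bit_or u [seq bits q (W i) | i <- elts T]).
  rewrite [map (fun i : 'I_N => _) _](map_comp enc_nat val) -/(elts T).
  elim: (elts T) us_in u => //= i us IH /andP[ivs usvs] u su.
  have iG : index i vs < size G by rewrite (leq_trans _ vsG) ?index_mem.
  rewrite lookup_dataE // (nth_map [::]) // -/(W i) or_dataE ?su ?size_bitsG ?WG // IH //.
  by rewrite size_map size_zip su size_bitsG ?WG // minnn.
rewrite foldE ?size_nseq // /enc_bits /enc_point; congr enc_list; congr map.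
set us := map _ _.
have us_size : all (fun v => size v == l * q) us.
  rewrite all_map; apply/allP => i /(allP us_in) ivs /=; by rewrite size_bitsG ?WG.
have size_l : size (foldl bit_or (nseq (l * q) false) us) = l * q.
  elim: us us_size (nseq _ _) (size_nseq (l * q) false) => //= v us IH /andP[/eqP sv su] u uu.
  by rewrite IH // size_map size_zip sv uu minnn.
apply: (@eq_from_nth _ false) => [|p]; rewrite size_l ?size_tuple // => pd.
have [_ ->] := nth_foldl_bit_or (size_nseq (l * q) false) us_size pd.
rewrite nth_nseq pd /= -(tnth_nth false (union_point B T) (Ordinal pd)) tnth_mktuple.
apply/hasP/bigcupP => [[v /mapP[i]]|[i iT]].
  move=> iT -> nb; have /mapP[j jT ij] := iT; rewrite mem_enum in jT.
  by exists j => //; rewrite BE ?(mem_vs T) // inE -ij.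
have ivs := mem_vs T i TE iT.
rewrite BE // inE => nb; exists (bits q (W i)) => //.
by apply/mapP; exists (val i); rewrite // map_f ?mem_enum.
Qed.

(** * Distances to an arbitrary center *)

Local Open Scope ring_scope.

Import Order.TTheory GRing.Theory Num.Theory.
Local Open Scope ring_scope.

(** * Sets meeting a small set in many vertices *)

Lemma exists_subset_card (T : finType) (A : {set T}) n : (n <= #|A|)%N ->
  exists2 S : {set T}, S \subset A & #|S| = n.
Proof.
move=> nA; exists [set x in take n (enum A)].
  by apply/subsetP => x; rewrite inE => /mem_take; rewrite mem_enum.
rewrite cardsE; have /card_uniqP-> := take_uniq n (enum_uniq A).
by rewrite size_takel // -cardE.
Qed.

(** Such a T consists of a (y + 1)-subset of [H], with at most 2 ^ |H| choices, and z - y - 1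
    further vertices. This is the exponent in the condition on |E|. *)
Lemma card_heavy_sets N z y (E : {set {set 'I_N}}) (H : {set 'I_N}) :
  (forall T, T \in E -> #|T| = z) ->
  (#|[set T in E | (y < #|T :&: H|)%N]| <= 2 ^ #|H| * N ^ (z - y - 1))%N.
Proof.
move=> Ez; pose draws := [set D : {set 'I_N} | #|D| == (z - y - 1)%N].
apply: (@leq_trans #|[set p.1 :|: p.2 | p in setX (powerset H) draws]|).
  apply/subset_leq_card/subsetP => T; rewrite inE => /andP[TE yT].
  have [S SH Sy] := exists_subset_card yT.
  have [ST SsubH] : S \subset T /\ S \subset H by apply/andP; rewrite -subsetI.
  apply/imsetP; exists (S, T :\: S); last first.
    by rewrite /= -{1}(setID T S) (setIidPr ST).
  rewrite inE /= !inE SsubH cardsD (setIidPr ST) Sy Ez //=; apply/eqP; lia.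
apply: leq_trans (leq_imset_card _ _) _; rewrite cardsX card_powerset leq_mul2l.
apply/orP; right; rewrite card_draws card_ord.
apply: (@leq_trans (N ^_ (z - y - 1))).
  by rewrite -bin_ffact leq_pmulr ?fact_gt0.
elim: (z - y - 1)%N => // n IH; rewrite ffactnSr expnSr leq_mul //; lia.
Qed.

(** * Mass of a [0,1]-valued function on coordinate sets *)

Section Mass.
Variables (R : realFieldType) (d : nat) (f : 'I_d -> R).
Hypotheses (f0 : forall p, 0 <= f p) (f1 : forall p, f p <= 1).

Definition mass (A : {set 'I_d}) : R := \sum_(p in A) f p.

Lemma mass_ge0 A : 0 <= mass A.
Proof. by apply: sumr_ge0. Qed.

Lemma mass_le_card A : mass A <= #|A|%:R.
Proof. by rewrite -sumr_const ler_sum. Qed.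

Lemma mass_subset (A C : {set 'I_d}) : A \subset C -> mass A <= mass C.
Proof.
move=> sAC; rewrite /mass [leRHS](big_setID A) /= (setIidPr sAC) lerDl.
by apply: sumr_ge0.
Qed.

Lemma massUI A C : mass (A :|: C) + mass (A :&: C) = mass A + mass C.
Proof.
have -> : mass C = mass (A :&: C) + mass (C :\: A).
  by rewrite /mass (big_setID A) /= setIC.
have -> : mass (A :|: C) = mass A + mass (C :\: A).
  by rewrite /mass (big_setID A) /= setUK setDUl setDv set0U.
by ring.
Qed.

Lemma massU_le A C : mass (A :|: C) <= mass A + mass C.
Proof. by rewrite -massUI lerDl mass_ge0. Qed.

Variables (I : finType) (B : I -> {set 'I_d}).

Lemma mass_bigcup_le (s : seq I) (X : {set 'I_d}) :
  mass (X :&: \bigcup_(i <- s) B i) <= \sum_(i <- s) mass (X :&: B i).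
Proof.
elim: s => [|i s IH]; rewrite ?big_nil ?setI0 /mass ?big_set0 // -/mass.
by rewrite !big_cons setIUr; apply: le_trans (massU_le _ _) _; rewrite lerD2l.
Qed.

(* Second Bonferroni inequality: the overlaps are paid for by at most |s|^2
   pairwise intersections. *)
Lemma sum_mass_le ov (s : seq I) : 0 <= ov ->
  (forall i j, i != j -> #|B i :&: B j|%:R <= ov) -> uniq s ->
  \sum_(i <- s) mass (B i) <= mass (\bigcup_(i <- s) B i) + (size s ^ 2)%:R * ov.
Proof.
move=> ov0 Bov; elim: s => [_|i s IH /= /andP[is_ us]].
  by rewrite !big_nil mul0r addr0 mass_ge0.
rewrite !big_cons; have := IH us; set U := \bigcup_(j <- s) B j => IHs.
have UI : mass (B i :&: U) <= (size s)%:R * ov.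
  apply: le_trans (mass_bigcup_le _ _) _.
  rewrite -sum1_size natr_sum mulr_suml big_seq [leRHS]big_seq.
  apply: ler_sum => j js; rewrite mul1r; apply: le_trans (mass_le_card _) (Bov _ _ _).
  by apply: contraNneq is_ => ->.
have := massUI (B i) U.
have -> : ((size s).+1 ^ 2)%:R * ov = (size s ^ 2)%:R * ov + (size s)%:R * ov
    + (size s).+1%:R * ov :> R.
  by rewrite -!mulrDl -!natrD; congr (_%:R * _); lia.
have : 0 <= (size s).+1%:R * ov by rewrite mulr_ge0.
by lra.
Qed.

End Mass.

(** * Lower bounds on the distance from a center *)

Definition clip (R : realType) (d : nat) (c : 'rV[R]_d) (p : 'I_d) : R :=
  Num.min 1 (Num.max 0 (c 0 p)).

Lemma clip_ge0 (R : realType) d (c : 'rV[R]_d) p : 0 <= clip c p.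
Proof. by rewrite /clip le_min ler01 le_max lexx. Qed.

Lemma clip_le1 (R : realType) d (c : 'rV[R]_d) p : clip c p <= 1.
Proof. by rewrite /clip ge_min lexx. Qed.

(** Clipping a coordinate to [0,1] does not move it away from a bit b, and for f in [0,1] the
    distance |b - f| equals b + f - 2 b f. Summed up, this expresses distances through cardinalities
    and masses. *)
Lemma clip_dist (R : realType) d (c : 'rV[R]_d) p (b : bool) :
  b%:R + clip c p - 2 * (if b then clip c p else 0) <= `|b%:R - c 0 p|.
Proof.
rewrite /clip minEle maxEle; case: b; rewrite /= ?mulr1n ?mulr0n ?sub0r ?normrN.
  have := ler_norm (1 - c 0 p); have := normr_ge0 (1 - c 0 p).
  by case: (leP 0 (c 0 p)) => ?; [case: (leP 1 (c 0 p))|case: (leP 1 0)] => ?; lra.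
have := ler_norm (c 0 p); have := normr_ge0 (c 0 p).
by case: (leP 0 (c 0 p)) => ?; [case: (leP 1 (c 0 p))|case: (leP 1 0)] => ?; lra.
Qed.

Lemma l1_dist_union_point_ge (R : realType) N d (B : 'I_N -> {set 'I_d})
    (T : {set 'I_N}) (c : 'rV[R]_d) (U := \bigcup_(i in T) B i) :
  #|U|%:R + mass (clip c) [set: 'I_d] - 2 * mass (clip c) U <=
  l1_dist (union_point B T) c.
Proof.
rewrite /mass /l1_dist -sumr_const mulr_sumr.
rewrite (eq_bigl xpredT (fun p => clip c p)) => [|p]; last by rewrite inE.
rewrite (big_mkcond (mem U) (fun=> 1)) (big_mkcond (mem U) (fun p => 2 * _)) /=.
rewrite -sumrN -!big_split /=; apply: ler_sum => p _.
rewrite tnth_mktuple -/U.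
by have := clip_dist c p (p \in U); case: (p \in U) => /=; lra.
Qed.

Lemma sum_le_card (R : realType) (I : finType) (A : {set I}) (w : I -> R) b :
  (forall i, i \in A -> w i <= b) -> \sum_(i in A) w i <= #|A|%:R * b.
Proof. by move=> wb; rewrite mulr_natl -sumr_const ler_sum. Qed.

(* For a center c, the heavy vertices are those whose block carries a fraction
   at least t of the mass a block can carry.  There are at most m of them, and
   all sets close to c with at most y heavy vertices share the same y heavy
   vertices, which form S. *)
Lemma center_structure (R : realType) (z y N d l m : nat) (E : {set {set 'I_N}})
    (B : 'I_N -> {set 'I_d}) (delta t : R)
    (e := 5 * z%:R ^+ 2 * delta + 2 * z%:R * t) (c : 'rV[R]_d) :
  (1 <= y)%N -> (y < z)%N -> (0 < l)%N -> 0 <= delta -> 0 <= t ->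
  3 * z%:R + m%:R ^+ 2 * delta < m%:R * t ->
  E != finset.set0 -> (forall T, T \in E -> #|T| = z) ->
  (forall i, (#|B i| <= l)%N) -> (forall T i, T \in E -> i \in T -> #|B i| = l) ->
  (forall i j, i != j -> #|B i :&: B j|%:R <= delta * l%:R) ->
  exists H S : {set 'I_N}, [/\ (#|H| <= m)%N, #|S| = y &
    forall T, T \in E -> (#|T :&: H| <= y)%N ->
      (z%:R - y%:R - e) * l%:R <= l1_dist (union_point B T) c /\
      (~~ (S \subset T) -> (z%:R - y%:R + 1 - e) * l%:R <= l1_dist (union_point B T) c)].
Proof.
have eE : e = 5 * z%:R ^+ 2 * delta + 2 * z%:R * t by [].
clearbody e; move=> y1 yz l0 dl0 t0 mP /set0Pn[T0 T0E] Ez Bl BE Bov.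
pose f := clip c; have f0 := clip_ge0 c; have f1 := clip_le1 c.
pose nrm := mass f [set: 'I_d]; pose w i := mass f (B i).
have l0R : 0 < l%:R :> R by rewrite ltr0n.
have z1R : 1 <= z%:R :> R by rewrite ler1n (leq_trans y1) // ltnW.
have y1R : 1 <= y%:R :> R by rewrite ler1n.
have ov0 : 0 <= delta * l%:R by rewrite mulr_ge0 // ltW.
have w0 i : 0 <= w i by exact: mass_ge0.
have wl i : w i <= l%:R by apply: le_trans (mass_le_card f1 _) _; rewrite ler_nat.
have w_sum (A : {set 'I_N}) : \sum_(i in A) w i <= nrm + #|A|%:R ^+ 2 * (delta * l%:R).
  rewrite -big_enum /=; apply: le_trans (sum_mass_le f0 f1 ov0 Bov (enum_uniq _)) _.
  by rewrite -cardE natrX lerD2r; apply: mass_subset => //; exact: subsetT.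
have w_card (A : {set 'I_N}) : \sum_(i in A) w i <= #|A|%:R * l%:R by exact: sum_le_card.
have cardU T : T \in E -> z%:R * l%:R - z%:R ^+ 2 * (delta * l%:R) <=
    #|\bigcup_(i in T) B i|%:R :> R.
  (* For the constant function 1 the mass is the cardinality, so the Bonferroni bound applies to the
     size of the union. *)
  move=> TE; pose g (_ : 'I_d) : R := 1.
  have gE A : mass g A = #|A|%:R by rewrite /mass sumr_const.
  have := @sum_mass_le R d g (fun=> ler01) (fun=> lexx 1) _ B _ (enum T) ov0 Bov (enum_uniq _).
  rewrite -cardE Ez // natrX !big_enum /= gE.
  rewrite (eq_bigr (fun=> l%:R)) => [|i iT]; last by rewrite gE (BE T).
  by rewrite sumr_const Ez // -mulr_natl; lra.
have massU (T : {set 'I_N}) : mass f (\bigcup_(i in T) B i) <= \sum_(i in T) w i.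
  rewrite -[X in mass f X]setTI -big_enum /= -[leRHS]big_enum /=.
  apply: le_trans (mass_bigcup_le f0 _ _ _) _.
  by apply: ler_sum => i _; rewrite setTI.
set dist := fun T => l1_dist (union_point B T) c.
have distE T : T \in E ->
    (z%:R - z%:R ^+ 2 * delta) * l%:R + nrm - 2 * (\sum_(i in T) w i) <= dist T.
  move=> TE; have := l1_dist_union_point_ge B T c; have := cardU T TE; have := massU T.
  by rewrite -/nrm -/f /dist; lra.
(* A center of mass above 3 z l is at distance about 2 z l or more from every point, so no vertex
   need count as heavy and any S will do. *)
have [big|small] := ltP (3 * z%:R * l%:R) nrm.
  have [S _ Sy] : exists2 S : {set 'I_N}, S \subset T0 & #|S| = y.
    by apply: exists_subset_card; rewrite Ez // ltnW.
  exists finset.set0, S; split=> //; first by rewrite cards0.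
  move=> T TE _; have := distE T TE; have := w_card T; rewrite Ez //.
  have e0 : 0 <= (4 * z%:R ^+ 2 * delta + 2 * z%:R * t) * l%:R.
    by apply: mulr_ge0 (ltW l0R); apply: addr_ge0; do !apply: mulr_ge0; rewrite ?sqr_ge0 ?ler0n.
  have : 0 <= (y%:R - 1) * l%:R :> R by rewrite mulr_ge0 ?subr_ge0 // ltW.
  have : 0 <= z%:R * l%:R :> R by rewrite mulr_ge0 ?ler0n.
  rewrite eE; split=> [|_]; rewrite -/(dist T); lra.
pose H := [set i | t * l%:R <= w i].
(* Any m heavy vertices carry mass at least m t l, yet together at most 3 z l plus m ^ 2 overlaps of
   delta l, contrary to the choice of m. *)
have cardH : (#|H| <= m)%N.
  rewrite leqNgt; apply/negP => /ltnW/exists_subset_card[A AH Am].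
  have : m%:R * (t * l%:R) <= \sum_(i in A) w i.
    rewrite mulr_natl -Am -sumr_const; apply: ler_sum => i /(subsetP AH).
    by rewrite inE.
  have := w_sum A; rewrite Am => h1 h2.
  have : m%:R * t * l%:R <= (3 * z%:R + m%:R ^+ 2 * delta) * l%:R by lra.
  by rewrite ler_pM2r // leNgt mP.
pose Y T := T :&: H.
have Ysub T : T \in E -> (#|Y T| <= z)%N.
  by move=> TE; rewrite -(Ez _ TE) subset_leq_card ?subsetIl.
have key T : T \in E ->
    (z%:R - z%:R ^+ 2 * delta - 2 * z%:R * t) * l%:R + nrm - 2 * (\sum_(i in Y T) w i) <= dist T.
  move=> TE; have := distE T TE; rewrite (big_setID H) /= -/(Y T).
  have : \sum_(i in T :\: H) w i <= z%:R * (t * l%:R).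
    apply: le_trans (_ : #|T :\: H|%:R * (t * l%:R) <= _).
      by apply: sum_le_card => i; rewrite !inE -ltNge => /andP[/ltW].
    rewrite ler_wpM2r ?mulr_ge0 ?ler0n // ler_nat -(Ez _ TE).
    by rewrite subset_leq_card ?subsetDl.
  by lra.
(* The heavy mass is at most n l, and also at most [nrm] plus overlaps. Adding the two bounds
   cancels [nrm] in [key]. *)
have few T n : T \in E -> (#|Y T| <= n)%N -> (z%:R - n%:R - e) * l%:R <= dist T.
  move=> TE Yn; have := key T TE.
  have : \sum_(i in Y T) w i <= n%:R * l%:R.
    by apply: le_trans (w_card _) _; rewrite ler_pM2r // ler_nat.
  have : \sum_(i in Y T) w i <= nrm + z%:R ^+ 2 * (delta * l%:R).
    apply: le_trans (w_sum _) _; rewrite lerD2l ler_wpM2r //.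
    by rewrite -!natrX ler_nat leq_sqr Ysub.
  have : 0 <= z%:R ^+ 2 * (delta * l%:R) by rewrite mulr_ge0 ?sqr_ge0.
  by rewrite eE; lra.
(* The two heavy masses add up to that of the union, at most [nrm] plus (2z) ^ 2 overlaps, and that
   of the intersection, at most y - 1 blocks. The two distances together lose 2 z^2 delta in [key]
   and 8 z^2 delta in the union, whence the 5 in [e]. *)
have pair T1 T2 : T1 \in E -> T2 \in E -> #|Y T1| = y -> #|Y T2| = y -> Y T1 != Y T2 ->
    2 * ((z%:R - y%:R + 1 - e) * l%:R) <= dist T1 + dist T2.
  move=> T1E T2E Y1 Y2 Y12; have := key T1 T1E; have := key T2 T2E.
  have wUI : \sum_(i in Y T1 :|: Y T2) w i + \sum_(i in Y T1 :&: Y T2) w i =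
      \sum_(i in Y T1) w i + \sum_(i in Y T2) w i.
    rewrite (big_setID (Y T1)) /= setUK setDUl setDv set0U.
    by rewrite [X in _ = _ + X](big_setID (Y T1)) /= [Y T2 :&: Y T1]setIC; ring.
  have : \sum_(i in Y T1 :&: Y T2) w i <= (y%:R - 1) * l%:R.
    apply: le_trans (w_card _) _; rewrite ler_pM2r // lerBrDr natr1 ler_nat.
    rewrite -[ltnRHS]Y1 proper_card // properE subsetIl /=.
    apply: contra Y12 => sub; rewrite eqEcard Y1 Y2 leqnn andbT.
    by apply: subset_trans sub _; exact: subsetIr.
  have : \sum_(i in Y T1 :|: Y T2) w i <= nrm + (2 * z%:R) ^+ 2 * (delta * l%:R).
    apply: le_trans (w_sum _) _; rewrite lerD2l ler_wpM2r //.
    rewrite -natrM -!natrX ler_nat leq_sqr; apply: leq_trans (leq_card_setU _ _) _.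
    by rewrite Y1 Y2 addnn -mul2n leq_mul2l ltnW.
  by rewrite eE; lra.
exists H.
(* If some close T1 has exactly y heavy vertices, these form S: by [pair], no close T has y other
   heavy vertices. If there is no such T1, any S works. *)
have [T1 /andP[T1E /andP[/eqP Y1 close1]]|no_close] :=
    pickP (fun T => [&& T \in E, #|Y T| == y & dist T < (z%:R - y%:R + 1 - e) * l%:R]).
  exists (Y T1); split=> // T TE YTy; split; first exact: few.
  move=> nsub; have [YT|YT] := ltnP #|Y T| y.
    have := few T y.-1 TE; rewrite -ltnS prednK // => /(_ YT).
    by rewrite -subn1 natrB //; rewrite -/(dist T); lra.
  have YTe : #|Y T| = y by apply/eqP; rewrite eqn_leq YTy.
  have : Y T1 != Y T by apply: contraNneq nsub => ->; exact: subsetIl.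
  by move=> /(pair _ _ T1E TE Y1 YTe); rewrite -/(dist T); lra.
have [S _ Sy] : exists2 S : {set 'I_N}, S \subset T0 & #|S| = y.
  by apply: exists_subset_card; rewrite Ez // ltnW.
exists S; split=> // T TE YTy; split; first exact: few.
move=> _; have [YT|YT] := ltnP #|Y T| y.
  have := few T y.-1 TE; rewrite -ltnS prednK // => /(_ YT).
  by rewrite -subn1 natrB //; rewrite -/(dist T); lra.
have := no_close T; rewrite TE (_ : #|Y T| == y) /=; last by rewrite eqn_leq YTy.
by move=> /negbT; rewrite -leNgt.
Qed.

(** * Completeness, and the cost in the soundness case *)

Lemma card_bigcup_le (I T : finType) (A : {set I}) (F : I -> {set T}) :
  (#|\bigcup_(i in A) F i| <= \sum_(i in A) #|F i|)%N.
Proof.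
elim/big_rec2: _ => [|i n X _ IH]; first by rewrite cards0.
by apply: leq_trans (leq_card_setU _ _) _; rewrite leq_add2l.
Qed.

(** If i is in T1 but not in T2, equal unions force the z blocks of T2 to cover the block of i,
    although each contains at most l / D of its l elements; this contradicts z < D. *)
Lemma union_point_inj D l z N d (E : {set {set 'I_N}}) (B : 'I_N -> {set 'I_d}) :
  (z < D)%N -> (0 < l)%N -> (forall T, T \in E -> #|T| = z) -> nearly_disjoint D l E B ->
  {in E &, injective (union_point B)}.
Proof.
move=> zD l0 Ez [_ BE Bov] T1 T2 T1E T2E BT.
have UT p : (p \in \bigcup_(i in T1) B i) = (p \in \bigcup_(i in T2) B i).
  have := congr1 (fun a : d.-tuple bool => tnth a p) BT.
  by rewrite !tnth_mktuple.
apply/eqP; rewrite eqEcard (Ez _ T1E) (Ez _ T2E) leqnn andbT.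
apply/subsetP => i iT1; apply/negPn/negP => iT2.
have cover_i : (#|B i| <= \sum_(j in T2) #|B i :&: B j|)%N.
  apply: leq_trans (card_bigcup_le _ _); apply/subset_leq_card/subsetP => p pi.
  have : p \in \bigcup_(j in T2) B j by rewrite -UT; apply/bigcupP; exists i.
  by case/bigcupP => j jT pj; apply/bigcupP; exists j => //; rewrite inE pi.
have : (D * #|B i| <= \sum_(j in T2) l)%N.
  apply: leq_trans (_ : \sum_(j in T2) D * #|B i :&: B j| <= _)%N.
    by rewrite -big_distrr leq_mul2l cover_i orbT.
  by apply: leq_sum => j jT2; apply: Bov; apply: contraNneq iT2 => ->.
rewrite sum_nat_const (Ez _ T2E) (BE _ _ T1E iT1).
by rewrite leq_pmul2r // leqNgt zD.
Qed.

(** The center for [S i] is the union of its blocks. The point of a T containing [S i] differs from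
    it only inside the z - y remaining blocks, hence in at most (z - y) l coordinates. *)
Lemma completeness (R : realType) D l z y N d k (E : {set {set 'I_N}})
    (B : 'I_N -> {set 'I_d}) (rho : R) (P := [set union_point B T | T in E]) :
  (forall T, T \in E -> #|T| = z) -> nearly_disjoint D l E B ->
  ((z - y) * l)%:R ^+ 2 <= rho * ln #|P|%:R ^+ 2 ->
  johnson_complete y E k -> kmeans_complete rho P k.
Proof.
move=> Ez [Bl _ _] rhoP [S [Sy SE]].
pose U (T : {set 'I_N}) := \bigcup_(i in T) B i.
pose c i : 'rV[R]_d := \row_p (p \in U (S i))%:R.
pose close a i := l1_dist a (c i) <= ((z - y) * l)%:R.
(* By [closeP], the default 0 is never taken on [P]. *)
pose sigma a := if [pick i | close a i] is Some i then c i else 0.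
have closeP a : a \in P -> exists i, close a i.
  case/imsetP => T TE ->; have [i ST] := SE T TE; exists i; rewrite /close.
  have -> : l1_dist (union_point B T) (c i) = #|U T :\: U (S i)|%:R.
    rewrite /l1_dist -sum1_card natr_sum [RHS]big_mkcond /=; apply: eq_bigr => p _.
    rewrite tnth_mktuple mxE !inE -/(U T).
    have [pS|pS] /= := boolP (p \in U (S i)); last first.
      by case: (p \in U T); rewrite subr0 ?normr1 ?normr0.
    suff -> : p \in U T by rewrite subrr normr0.
    case/bigcupP: pS => j jS pj; apply/bigcupP; exists j => //; exact: (subsetP ST).
  rewrite ler_nat; apply: leq_trans (_ : #|U (T :\: S i)| <= _)%N.
    apply/subset_leq_card/subsetP => p; rewrite inE => /andP[pS /bigcupP[j jT pj]].
    apply/bigcupP; exists j => //; rewrite inE jT andbT.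
    by apply: contra pS => jS; apply/bigcupP; exists j.
  apply: leq_trans (card_bigcup_le _ _) _.
  apply: leq_trans (leq_sum _ _ : _ <= \sum_(j in T :\: S i) l)%N _ => //.
  by rewrite sum_nat_const cardsD (setIidPr ST) Ez // Sy.
exists c, sigma; split=> [a /closeP[i ci]|].
  by rewrite /sigma; case: pickP => [j _|/(_ i)]; [exists j|rewrite ci].
rewrite /kmeans_cost; apply: le_trans (_ : \sum_(a in P) ((z - y) * l)%:R ^+ 2 <= _).
  apply: ler_sum => a aP; rewrite lerXn2r ?nnegrE //.
    by apply: sumr_ge0.
  rewrite /sigma; case: pickP => [//|noclose].
  by have [i ci] := closeP a aP; rewrite noclose in ci.
by rewrite sumr_const -[leLHS]mulr_natr [leRHS]mulrAC ler_wpM2r.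
Qed.

(** Nothing is claimed about sets with more than y heavy vertices for some center; they are few by
    [card_heavy_sets]. Of the others, those containing some [S i] are at distance at least a l, and
    their number is bounded by soundness; the rest are at distance at least (a + 1) l. *)
Lemma kmeans_cost_ge (R : realType) (z y N d l m k : nat) (E : {set {set 'I_N}})
    (B : 'I_N -> {set 'I_d}) (delta t alpha : R)
    (a := z%:R - y%:R - (5 * z%:R ^+ 2 * delta + 2 * z%:R * t)) (sigma : d.-tuple bool -> 'rV[R]_d)
    (c : 'I_k -> 'rV[R]_d) (P := [set union_point B T | T in E]) :
  (1 <= y)%N -> (y < z)%N -> (0 < l)%N -> 0 <= delta -> 0 <= t -> 0 <= a ->
  3 * z%:R + m%:R ^+ 2 * delta < m%:R * t ->
  E != finset.set0 -> (forall T, T \in E -> #|T| = z) ->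
  (forall i, (#|B i| <= l)%N) -> (forall T i, T \in E -> i \in T -> #|B i| = l) ->
  (forall i j, i != j -> #|B i :&: B j|%:R <= delta * l%:R) ->
  {in E &, injective (union_point B)} ->
  johnson_sound alpha y E k -> maps_into_centers P c sigma ->
  l%:R ^+ 2 * (((a + 1) ^+ 2 - ((a + 1) ^+ 2 - a ^+ 2) * alpha) * #|E|%:R
     - (a + 1) ^+ 2 * (k * (2 ^ m * N ^ (z - y - 1)))%:R) <= kmeans_cost P sigma.
Proof.
have aE : a = z%:R - y%:R - (5 * z%:R ^+ 2 * delta + 2 * z%:R * t) by [].
clearbody a; move=> y1 yz l0 dl0 t0 a0 mP En0 Ez Bl BE Bov inj sound into.
have /fin_all_exists[H /fin_all_exists[S HS]] i :=
  center_structure (c i) y1 yz l0 dl0 t0 mP En0 Ez Bl BE Bov.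
pose bad := \bigcup_(i in [set: 'I_k]) [set T in E | (y < #|T :&: H i|)%N].
pose cov := [set T in E | [exists i, S i \subset T]].
have card_bad : (#|bad| <= k * (2 ^ m * N ^ (z - y - 1)))%N.
  apply: leq_trans (card_bigcup_le _ _) _; rewrite -[k in leqRHS]card_ord -cardsT -sum_nat_const.
  apply: leq_sum => i _; apply: leq_trans (card_heavy_sets _ _ Ez) _.
  by rewrite leq_mul2r leq_exp2l //; have [-> _ _] := HS i; rewrite orbT.
have card_cov : #|cov|%:R <= alpha * #|E|%:R.
  by apply: sound => i; have [_ ->] := HS i.
have l0R : 0 <= l%:R :> R by rewrite ler0n.
(* The indicators merge the three cases; for bad T the left side is at most 0. *)
have dist_ge T : T \in E -> l%:R ^+ 2 * ((a + 1) ^+ 2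
    - ((a + 1) ^+ 2 - a ^+ 2) * (T \in cov)%:R - (a + 1) ^+ 2 * (T \in bad)%:R) <=
    l1_dist (union_point B T) (sigma (union_point B T)) ^+ 2.
  move=> TE; have [i ->] := into _ (imset_f (union_point B) TE).
  have [_ _ /(_ T TE) HT] := HS i.
  have [Tbad|Tbad] := boolP (T \in bad).
    apply: le_trans (_ : 0 <= _); last exact: sqr_ge0.
    rewrite pmulr_rle0 ?exprn_gt0 ?ltr0n // mulr1.
    have : 0 <= (2 * a + 1) * (T \in cov)%:R by rewrite mulr_ge0 ?ler0n //; lra.
    have : 0 <= a ^+ 2 by exact: sqr_ge0.
    by lra.
  have {}HT : (#|T :&: H i| <= y)%N.
    by rewrite leqNgt; apply: contra Tbad => yT; apply/bigcupP; exists i => //; rewrite inE TE.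
  have sq b : 0 <= b -> b * l%:R <= l1_dist (union_point B T) (c i) ->
      l%:R ^+ 2 * b ^+ 2 <= l1_dist (union_point B T) (c i) ^+ 2.
    move=> b0 bl; rewrite -exprMn mulrC lerXn2r ?nnegrE ?mulr_ge0 //.
    by apply: le_trans bl; rewrite mulr_ge0.
  have [_ _ /(_ T TE HT)[far1 far2]] := HS i.
  have [Tcov|Tcov] := boolP (T \in cov); rewrite ?mulr1 ?mulr0 ?subr0.
    by rewrite subKr; apply: sq => //; rewrite aE.
  apply: sq; first by lra.
  rewrite aE -addrAC; apply: far2; apply: contra Tcov => ST.
  by rewrite inE TE; apply/existsP; exists i.
rewrite /kmeans_cost big_imset //=; apply: le_trans (ler_sum _ dist_ge).
rewrite -mulr_sumr ler_wpM2l ?exprn_ge0 // !sumrB !sumr_const -!mulr_sumr.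
have sum_ind (X : {set {set 'I_N}}) : X \subset E -> \sum_(T in E) (T \in X)%:R = #|X|%:R :> R.
  move=> XE; rewrite -natr_sum -sum1_card big_mkcond [in RHS]big_mkcond /=; congr _%:R.
  by apply: eq_bigr => T _; case: ifP => //; have := subsetP XE T; case: (T \in X) => // ->.
rewrite !sum_ind; last 2 first.
- by apply/bigcupsP => i _; apply/subsetP => T; rewrite inE => /andP[].
- by apply/subsetP => T; rewrite inE => /andP[].
have : ((a + 1) ^+ 2 - a ^+ 2) * #|cov|%:R <= ((a + 1) ^+ 2 - a ^+ 2) * (alpha * #|E|%:R).
  by apply: ler_wpM2l => //; lra.
have : (a + 1) ^+ 2 * #|bad|%:R <= (a + 1) ^+ 2 * (k * (2 ^ m * N ^ (z - y - 1)))%:R.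
  by rewrite ler_wpM2l ?sqr_ge0 // ler_nat.
by rewrite -mulr_natr; lra.
Qed.

(** * The hardness result *)

Lemma enc_nat_inj : injective enc_nat.
Proof. by move=> m n mn; rewrite -(size_dlist_enc_nat m) mn size_dlist_enc_nat. Qed.

Lemma enc_subset_inj N : injective (@enc_subset N).
Proof.
move=> S T /(can_inj enc_listK)/inj_map eqST; apply/setP => i.
by rewrite -(mem_enum S) -(mem_enum T) eqST // => j k /enc_nat_inj/val_inj.
Qed.

(** The order of the list is free, but a code determines N, [E] and k. Using a predicate [Q] avoids
    an equation between families over different ground sets. *)
Lemma encodes_johnson_inj N N' (E : {set {set 'I_N}}) (E' : {set {set 'I_N'}}) k k' x
    (Q : forall n, {set {set 'I_n}} -> nat -> Prop) :
  encodes_johnson E k x -> encodes_johnson E' k' x -> Q N E k -> Q N' E' k'.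
Proof.
move=> [s sE ->] [s' sE' [/enc_nat_inj eN eS /enc_nat_inj <-]].
case: N' / eN in E' s' sE' eS *.
have ss' := inj_map (@enc_subset_inj N) (can_inj enc_listK eS).
suff -> : E' = E by [].
by apply/setP => T; rewrite -mem_enum -(perm_mem sE') -ss' (perm_mem sE) mem_enum.
Qed.

(** A classical equality test, used to state membership in a table; the computability of comparisons
    with constants is shown next. *)
HB.instance Definition _ := gen_eqMixin data.

Lemma decidable_eq_cst d f : computable f -> decidable_in_P (fun x => f x == d).
Proof.
elim: d f => [|a IHa b IHb] f cf.
  apply: computable_ext (decidable_negb (decidable_truthy cf)) => x.
  by case: (f x) => [|u v]; [rewrite eqxx|case: eqP].
apply: computable_ext (decidable_andb (decidable_truthy cf)
  (decidable_andb (IHa _ (computable_hd cf)) (IHb _ (computable_tl cf)))) => x.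
case: (f x) => [|u v] /=; first by case: eqP.
by congr enc_bool; apply/andP/eqP => [[/eqP-> /eqP->]|[-> ->]].
Qed.

Lemma decidable_mem_cst (s : seq data) : decidable_in_P (fun x => x \in s).
Proof.
elim: s => [|d s IH]; first exact: computable_cst.
apply: computable_ext (computable_ifb (decidable_eq_cst d computable_id)
  (computable_cst (Cons Nil Nil)) IH) => x.
by rewrite inE; case: eqP.
Qed.

Lemma small_johnson_instances n0 k0 : exists s : seq data,
  forall N (E : {set {set 'I_N}}) k x, (N <= n0)%N -> (k <= k0)%N ->
    encodes_johnson E k x -> x \in s.
Proof.
pose code N k (s : seq {set 'I_N}) :=
  Cons (enc_nat N) (Cons (enc_list [seq enc_subset T | T <- s]) (enc_nat k)).
exists (flatten [seq flatten [seq flatten [seq [seq code N k s | s <- permutations (enum E)]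
  | E : {set {set 'I_N}} <- enum {set {set 'I_N}}] | k <- iota 0 k0.+1] | N <- iota 0 n0.+1]).
move=> N E k x Nn kk [s sE ->].
apply/flatten_mapP; exists N; first by rewrite mem_iota.
apply/flatten_mapP; exists k; first by rewrite mem_iota.
apply/flatten_mapP; exists E; first by rewrite mem_enum.
by apply/mapP; exists s; rewrite ?mem_permutations // perm_sym.
Qed.

(** * Fixed k-means instances with known answer *)

Lemma kmeans_complete_card (R : realType) (rho : R) d (P : {set d.-tuple bool}) :
  0 <= rho -> kmeans_complete rho P #|P|.
Proof.
move=> rho0; pose row (a : d.-tuple bool) : 'rV[R]_d := \row_p (tnth a p)%:R.
exists (fun i => row (enum_val i)), row; split=> [a aP|].
  by exists (enum_rank_in aP a); rewrite enum_rankK_in.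
rewrite /kmeans_cost big1 => [|a _].
  by apply: mulr_ge0 (sqr_ge0 _); exact: mulr_ge0.
by rewrite /l1_dist big1 ?expr0n // => p _; rewrite mxE subrr normr0.
Qed.

(** Two opposite corners of the cube. A single center costs at least d ^ 2 / 2, so a large d meets
    any prescribed soundness bound. *)
Definition antipodes (d : nat) : {set d.-tuple bool} :=
  [set [tuple false | _ < d]; [tuple true | _ < d]].

Lemma antipodes_neq d : (0 < d)%N -> [tuple false | _ < d] != [tuple true | _ < d].
Proof.
case: d => // d _; apply/eqP => /(congr1 (fun a : _.-tuple bool => tnth a ord0)).
by rewrite !tnth_mktuple.
Qed.

Lemma card_antipodes d : (0 < d)%N -> #|antipodes d| = 2.
Proof. by move=> /antipodes_neq neq; rewrite cards2 neq. Qed.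

Lemma antipodes_cost_ge (R : realType) d (c : 'I_1 -> 'rV[R]_d) sigma : (0 < d)%N ->
  maps_into_centers (antipodes d) c sigma ->
  d%:R ^+ 2 / 2 <= kmeans_cost (antipodes d) sigma.
Proof.
move=> d0 into; rewrite /kmeans_cost big_setU1 ?inE ?antipodes_neq //= big_set1.
have [i ->] := into _ (set21 _ _); have [j ->] := into _ (set22 _ _).
rewrite (ord1 i) (ord1 j) => {i j}.
set u := l1_dist _ _; set v := l1_dist _ _.
have uv : d%:R <= u + v.
  rewrite -big_split /= -[d in d%:R]card_ord -sumr_const; apply: ler_sum => p _.
  rewrite !tnth_mktuple /=.
  have := ler_norm (1 - c ord0 0 p); have := ler_norm (- (0 - c ord0 0 p)); rewrite normrN.
  by lra.
have : d%:R ^+ 2 <= (u + v) ^+ 2.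
  by rewrite lerXn2r ?nnegrE ?ler0n //; apply: le_trans uv; rewrite ler0n.
have := sqr_ge0 (u - v); lra.
Qed.

Lemma encodes_kmeans_ex d (P : {set d.-tuple bool}) k : exists x, encodes_kmeans P k x.
Proof. by eexists; exists (enum P). Qed.

Lemma ln2_gt0 (R : realType) : 0 < ln 2 :> R.
Proof. by rewrite ln_gt0 // ltr1n. Qed.

Lemma kmeans_yes_ex (R : realType) (C rho : R) :
  0 <= rho -> 1 <= C * ln 2 -> exists x, kmeans_yes C rho x.
Proof.
move=> rho0 C1; pose P := [set: 1.-tuple bool].
have cardP : #|P| = 2 by rewrite cardsT card_tuple card_bool.
have [x Px] := encodes_kmeans_ex P #|P|.
exists x, 1, P, #|P|; split=> //; last exact: kmeans_complete_card.
by split; rewrite cardP.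
Qed.

Lemma kmeans_no_ex (R : realType) (C rho gamma : R) d : (0 < d)%N ->
  d%:R <= C * ln 2 -> gamma * rho * 2 * ln 2 ^+ 2 <= d%:R ^+ 2 / 2 ->
  exists x, kmeans_no C rho gamma x.
Proof.
move=> d0 dC gd; have [x Px] := encodes_kmeans_ex (antipodes d) 1.
exists x, d, (antipodes d), 1; split=> //; first by split; rewrite ?card_antipodes.
move=> c sigma into; rewrite card_antipodes //.
exact: le_trans gd (antipodes_cost_ge d0 into).
Qed.

(** For such gamma one instance satisfies both cases, and the constant map to it is a reduction: the
    points 0 and 1 on a line with one center, where [rho] puts the threshold at the optimal cost
    1/2. *)
Lemma kmeans_NP_hard_le1 (R : realType) (gamma : R) : gamma <= 1 ->
  exists rho : R, 0 < rho /\ exists C : R, NP_hard (kmeans_yes C rho) (kmeans_no C rho gamma).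
Proof.
move=> gamma1; have l2 := ln2_gt0 R.
have rhoE : (4 * ln 2 ^+ 2)^-1 * 2 * ln 2 ^+ 2 = 2^-1 :> R by field; exact: lt0r_neq0.
exists (4 * ln 2 ^+ 2)^-1; split; first by rewrite invr_gt0 mulr_gt0 // exprn_gt0.
exists (ln 2)^-1 => L _.
have [x Px] := encodes_kmeans_ex (antipodes 1) 1.
have inst : kmeans_instance (ln 2 : R)^-1 (antipodes 1) 1.
  by split; rewrite ?card_antipodes ?mulVf ?lt0r_neq0 ?ler1n.
exists (fun=> x); split; first exact/computable_polytime/computable_cst.
move=> y; split=> _; exists 1, (antipodes 1), 1; split=> //.
  exists (fun=> const_mx 2^-1), (fun=> const_mx 2^-1); split; first by exists ord0.
  rewrite /kmeans_cost card_antipodes // rhoE.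
  rewrite (eq_bigr (fun=> 4^-1)) => [|a _].
    by rewrite sumr_const card_antipodes // -mulr_natr; lra.
  rewrite /l1_dist big_ord1 mxE; case: (tnth a ord0) => /=.
    by rewrite ger0_norm; lra.
  by rewrite sub0r normrN ger0_norm; lra.
move=> c sigma into; rewrite card_antipodes //; apply: le_trans (antipodes_cost_ge _ into) => //.
by rewrite -!mulrA [X in _ * X]mulrA rhoE; lra.
Qed.

(** * Choice of constants and the numerical threshold *)

Lemma ln_trunc_log (R : realType) n (l := trunc_log 2 n) : (0 < n)%N ->
  l%:R * ln 2 <= ln n%:R :> R /\ ln n%:R <= (l%:R + 1) * ln 2 :> R.
Proof.
move=> n0; have /andP[lo hi] := trunc_log_bounds (isT : (1 < 2)%N) n0.
have lnX k : k%:R * ln 2 = ln (2 ^ k)%:R :> R by rewrite natrX lnXn // mulr_natl.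
rewrite natr1 !lnX; split; rewrite ler_ln ?posrE ?ltr0n ?expn_gt0 // ler_nat //.
exact: ltnW.
Qed.

(** The order is eta, t, m, D: t makes 2 z t half of eta, m makes m t exceed 4 z, and then a large D
    brings 5 z^2 / D to at most eta / 2 and m^2 / D to at most 1. *)
Lemma exists_constants (R : realType) (z : nat) (eps : R) : (0 < z)%N -> 0 < eps ->
  exists (D m : nat) (t eta : R), (1 < D)%N /\ (z < D)%N /\ 0 <= t /\ 0 < eta /\ eta <= 1 /\
    16 * eta <= eps /\ 5 * z%:R ^+ 2 * D%:R^-1 + 2 * z%:R * t <= eta /\
    3 * z%:R + m%:R ^+ 2 * D%:R^-1 < m%:R * t.
Proof.
move=> z0 eps0; have z1R : 1 <= z%:R :> R by rewrite ler1n.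
have z0R : 0 < z%:R :> R by rewrite ltr0n.
(* This value satisfies both eta <= 1 and 16 eta <= eps. *)
pose eta := eps / (16 + eps); have eta0 : 0 < eta by rewrite divr_gt0 // addr_gt0.
have etaE : eta * (16 + eps) = eps by rewrite divfK // lt0r_neq0 // addr_gt0.
pose t := eta / (4 * z%:R).
have t0 : 0 < t by rewrite divr_gt0 // mulr_gt0.
have tE : t * (4 * z%:R) = eta by rewrite divfK // lt0r_neq0 // mulr_gt0.
pose m := Num.bound (4 * z%:R / t).
have mP : 4 * z%:R < m%:R * t.
  by rewrite -ltr_pdivrMr //; apply: archi_boundP; rewrite divr_ge0 ?(ltW t0) ?mulr_ge0.
pose x := 10 * z%:R ^+ 2 / eta + m%:R ^+ 2 + z%:R + 1.
have u0 : 0 <= 10 * z%:R ^+ 2 / eta by rewrite divr_ge0 ?(ltW eta0) ?mulr_ge0 ?sqr_ge0.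
have v0 : 0 <= m%:R ^+ 2 :> R by exact: sqr_ge0.
have x0 : 0 <= x by rewrite /x; lra.
pose D := Num.bound x; have xD : x < D%:R by exact: archi_boundP.
have D0 : 0 < D%:R :> R by exact: le_lt_trans xD.
exists D, m, t, eta; do !split => //.
- by rewrite -(ltr_nat R); rewrite /x in xD; lra.
- by rewrite -(ltr_nat R); rewrite /x in xD; lra.
- exact: ltW.
- by nra.
- by nra.
- have : 5 * z%:R ^+ 2 / D%:R <= eta / 2.
    rewrite ler_pdivrMr //.
    have : 10 * z%:R ^+ 2 <= eta * D%:R.
      by rewrite [leRHS]mulrC -ler_pdivrMr //; rewrite /x in xD; lra.
    by lra.
  by lra.
have : m%:R ^+ 2 / D%:R <= 1 :> R by rewrite ler_pdivrMr // mul1r; rewrite /x in xD; lra.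
by lra.
Qed.

(** In the application s is z - y, lam is log2 n and l its floor. Half of the slack eps s^2 pays for
    replacing lam by l, the other half for the error e and the bad sets. The first alternative makes
    the bound on the cost trivial. *)
Lemma threshold_le (R : realType) (s alpha eps eta e l lam n bad : R) (a := s - e) :
  1 <= s -> 0 <= alpha -> 0 < eps -> 16 * eta <= eps -> eta <= 1 -> 0 <= e -> e <= eta ->
  0 <= n -> 0 <= lam -> lam <= l + 1 -> 1 <= l -> 24 <= l * eps -> bad <= eta * n ->
  (alpha * s ^+ 2 + (1 - alpha) * (s + 1) ^+ 2 - eps * s ^+ 2) * (n * lam ^+ 2) <= 0 \/
  (alpha * s ^+ 2 + (1 - alpha) * (s + 1) ^+ 2 - eps * s ^+ 2) * (n * lam ^+ 2) <=
  l ^+ 2 * (((a + 1) ^+ 2 - ((a + 1) ^+ 2 - a ^+ 2) * alpha) * n - (a + 1) ^+ 2 * bad).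
Proof.
move=> s1 al0 eps0 etaeps eta1 e0 eeta n0 lam0 laml l1 leps badn.
set G := alpha * _ + _ - _; have n_lam0 : 0 <= n * lam ^+ 2 by rewrite mulr_ge0 ?sqr_ge0.
have [G0|G0] := leP G 0; [left|right]; first by rewrite mulr_le0_ge0.
have l0 : 0 <= l by lra.
have ss : s <= s ^+ 2 by rewrite expr2 ler_peMr //; lra.
have a0 : 0 <= a by rewrite /a; lra.
have Gle : G <= 4 * s ^+ 2.
  have : 0 <= (2 * s + 1) * alpha by rewrite mulr_ge0 //; lra.
  have : 0 <= eps * s ^+ 2 by rewrite mulr_ge0 ?sqr_ge0 // ltW.
  by rewrite /G; lra.
(* Rounding loses at most 3 l in the square, times G <= 4 s^2; since 24 <= l eps, this loss is
   within l^2 eps s^2 / 2. *)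
have lamG : G * lam ^+ 2 <= l ^+ 2 * (G + eps * s ^+ 2 / 2).
  apply: le_trans (_ : G * (l + 1) ^+ 2 <= _).
    by rewrite ler_pM2l // lerXn2r ?nnegrE //; lra.
  have : G * (2 * l + 1) <= 4 * s ^+ 2 * (3 * l).
    by apply: ler_pM => //; lra.
  have : l * s ^+ 2 * 24 <= l * s ^+ 2 * (l * eps).
    by apply: ler_wpM2l => //; rewrite mulr_ge0 ?sqr_ge0.
  by lra.
have main : l ^+ 2 * (G + eps * s ^+ 2 / 2) * n <=
   l ^+ 2 * (((a + 1) ^+ 2 - ((a + 1) ^+ 2 - a ^+ 2) * alpha) * n - (a + 1) ^+ 2 * bad).
  rewrite -mulrA ler_wpM2l ?sqr_ge0 //.
  have : (a + 1) ^+ 2 * bad <= 4 * s ^+ 2 * (eta * n).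
    apply: le_trans (_ : (a + 1) ^+ 2 * (eta * n) <= _); first by rewrite ler_wpM2l ?sqr_ge0.
    apply: ler_wpM2r; first by rewrite mulr_ge0 //; lra.
    by rewrite (_ : 4 * s ^+ 2 = (2 * s) ^+ 2) ?lerXn2r ?nnegrE /a //; lra.
  have : (G + eps * s ^+ 2 / 2) * n <=
      ((a + 1) ^+ 2 - ((a + 1) ^+ 2 - a ^+ 2) * alpha - 4 * s ^+ 2 * eta) * n.
    apply: ler_wpM2r => //.
    have : 0 <= e * alpha by exact: mulr_ge0.
    have : e * (s + 1) <= eta * (2 * s ^+ 2) by apply: ler_pM => //; lra.
    have : 16 * eta * s ^+ 2 <= eps * s ^+ 2 by rewrite ler_wpM2r ?sqr_ge0.
    have := sqr_ge0 e.
    by rewrite /G /a; lra.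
  by lra.
by apply: le_trans main; rewrite mulrCA [n * _]mulrC ler_wpM2r.
Qed.

(** * The gap on instances with many sets *)

Lemma johnson_sound_ge0 (R : realType) (alpha : R) z y N (E : {set {set 'I_N}}) k :
  johnson_instance z E k -> (y <= z)%N -> johnson_sound alpha y E k -> 0 <= alpha.
Proof.
move=> [Ez En0 _] yz sound; have /set0Pn[T TE] := En0.
have [S _ Sy] : exists2 S : {set 'I_N}, S \subset T & #|S| = y.
  by apply: exists_subset_card; rewrite Ez.
have E0 : 0 < #|E|%:R :> R by rewrite ltr0n card_gt0.
by rewrite -(pmulr_lge0 _ E0); apply: le_trans (sound (fun=> S) _).
Qed.

(** With this [rho], the completeness cost ((z - y) l)^2 per point is at most rho (ln n)^2. A fixed
    factor [G] suffices in the growth condition, so only finitely many N will need separate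
    treatment. *)
Lemma gap_instance (R : realType) (z y : nat) (eps : R) (rho := ((z - y)%:R / ln 2) ^+ 2) :
  (1 <= y)%N -> (y < z)%N -> 0 < eps ->
  exists (D : nat) (G : R), forall N (E : {set {set 'I_N}}) k x,
    johnson_instance z E k -> encodes_johnson E k x ->
    G * k%:R * N%:R ^+ (z - y - 1) <= #|E|%:R ->
    exists d (P : {set d.-tuple bool}),
      [/\ encodes_kmeans P k (reduction D (letters_data (16 ^ D)) x),
          kmeans_instance ((16 ^ D)%:R / ln 2 : R) P k,
          johnson_complete y E k -> kmeans_complete rho P k &
          forall alpha : R, johnson_sound alpha y E k -> kmeans_sound rho
            (alpha + (1 - alpha) * ((z - y + 1)%:R ^+ 2 / (z - y)%:R ^+ 2) - eps) P k].
Proof.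
move=> y1 yz eps0; have z0 : (0 < z)%N by exact: leq_trans yz.
have [D [m [t [eta [D1 [zD [t0 [eta0 [eta1 [eta_eps [e_eta mP]]]]]]]]]]] :=
  exists_constants z0 eps0.
have l2 := ln2_gt0 R.
(* From l >= l0 follow z <= 2 ^ (l - 1), which provides enough codewords, and l eps >= 24. *)
pose l0 := (z + Num.bound (24 / eps)).+1; pose q := (16 ^ D)%N.
(* The first term keeps the number of bad sets below eta n; the second forces n >= 2 ^ l0, hence l
   >= l0. *)
exists D, ((2 ^ m)%:R / eta + (2 ^ l0)%:R) => N E k x inst enc starE.
have [Ez En0 k0] := inst; set n := #|E| in starE *.
have N1 : (1 <= N ^ (z - y - 1))%N.
  have /set0Pn[T TE] := En0; rewrite expn_gt0; apply/orP; left.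
  by have := max_card (mem T); rewrite Ez // card_ord; apply: leq_trans.
set W := (k * N ^ (z - y - 1))%N.
have W1 : 1 <= W%:R :> R by rewrite ler1n muln_gt0 k0.
have {}starE : ((2 ^ m)%:R / eta + (2 ^ l0)%:R) * W%:R <= n%:R :> R.
  by rewrite /W natrM [(N ^ _)%:R]natrX mulrA.
have c0 : 0 <= (2 ^ m)%:R / eta by rewrite divr_ge0 // ltW.
have n_l0 : (2 ^ l0 <= n)%N.
  rewrite -(ler_nat R); apply: le_trans starE.
  have : (2 ^ l0)%:R * 1 <= (2 ^ l0)%:R * W%:R :> R by rewrite ler_wpM2l.
  have : 0 <= (2 ^ m)%:R / eta * W%:R by rewrite mulr_ge0.
  by lra.
have n0 : (0 < n)%N by apply: leq_trans n_l0; rewrite expn_gt0.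
pose l := trunc_log 2 n.
have l0l : (l0 <= l)%N by exact: trunc_log_max.
have lpos : (0 < l)%N by exact: leq_trans l0l.
have bad_le : (k * (2 ^ m * N ^ (z - y - 1)))%:R <= eta * n%:R :> R.
  rewrite mulnCA -/W natrM -ler_pdivrMl // mulrA [_^-1 * _]mulrC; apply: le_trans starE.
  by rewrite ler_wpM2r // lerDl.
have zn : (z * n <= 8 ^ l)%N.
  have /andP[_ nl] := trunc_log_bounds (isT : (1 < 2)%N) n0.
  apply: (@leq_trans (2 ^ l.-1 * 2 ^ l.+1)).
    apply: leq_mul (ltnW nl); apply: leq_trans (ltnW (ltn_expl z (isT : 1 < 2)%N)) _.
    by rewrite leq_exp2l // -ltnS prednK // (leq_trans _ l0l) // /l0 !ltnS leq_addr.
  rewrite -expnD -[leqRHS](expnM 2 3 l) leq_exp2l // addnS -addSn prednK // addnn -mul2n.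
  by rewrite leq_mul2r orbT.
have [B [nd [s sE redE]]] := reductionE D1 lpos Ez zn enc.
have inj := union_point_inj zD lpos Ez nd.
pose P := [set union_point B T | T in E].
have cardP : #|P| = n by rewrite card_in_imset.
have [ln_lo ln_hi] := ln_trunc_log R n0.
have lnn0 : 0 <= ln n%:R :> R by rewrite ln_ge0 // ler1n.
exists (l * q)%N, P; split.
- exists [seq union_point B T | T <- s]; last by rewrite redE -map_comp.
  have s_uniq : uniq s by rewrite (perm_uniq sE) enum_uniq.
  apply: uniq_perm; [|exact: enum_uniq|].
    rewrite map_inj_in_uniq // => T T'; rewrite !(perm_mem sE) !mem_enum.
    exact: inj.
  move=> a; rewrite mem_enum; apply/mapP/imsetP => -[T]; rewrite ?(perm_mem sE) ?mem_enum => TE ->.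
    by exists T.
  by exists T; rewrite // (perm_mem sE) mem_enum.
- split=> //.
    rewrite cardP; apply: leq_trans n_l0; rewrite -[1%N]/(2 ^ 0)%N ltn_exp2l //.
  have -> : (l * q)%:R = q%:R / ln 2 * (l%:R * ln 2) :> R.
    by rewrite natrM; field; exact: lt0r_neq0.
  by rewrite cardP; apply: ler_wpM2l ln_lo; rewrite divr_ge0 // ltW.
- apply: completeness Ez nd _; rewrite cardP /rho -exprMn.
  have -> : ((z - y) * l)%:R = (z - y)%:R / ln 2 * (l%:R * ln 2) :> R.
    by rewrite natrM; field; exact: lt0r_neq0.
  have s_ge0 : 0 <= (z - y)%:R / ln 2 :> R by rewrite divr_ge0 // ltW.
  rewrite lerXn2r ?nnegrE; [by []| |exact: mulr_ge0|exact: ler_wpM2l].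
  by apply: mulr_ge0 => //; apply: mulr_ge0 => //; exact: ltW.
move=> alpha sound c sigma into.
have al0 := johnson_sound_ge0 inst (ltnW yz) sound.
rewrite cardP; have D0 : 0 < D%:R :> R by rewrite ltr0n ltnW.
have e0 : 0 <= 5 * z%:R ^+ 2 * D%:R^-1 + 2 * z%:R * t.
  by apply: addr_ge0; do !apply: mulr_ge0; rewrite ?sqr_ge0 ?invr_ge0 // ltW.
have sE' : (z - y)%:R = z%:R - y%:R :> R by rewrite natrB // ltnW.
have s1 : 1 <= (z - y)%:R :> R by rewrite ler1n subn_gt0.
pose lam : R := ln n%:R / ln 2.
(* The factor (z - y)^2 of [rho] clears the denominator, and its ln 2 turns ln n into log2 n. *)
have -> : (alpha + (1 - alpha) * ((z - y + 1)%:R ^+ 2 / (z - y)%:R ^+ 2) - eps) * rho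
    * n%:R * ln n%:R ^+ 2 =
    (alpha * (z - y)%:R ^+ 2 + (1 - alpha) * ((z - y)%:R + 1) ^+ 2 - eps * (z - y)%:R ^+ 2)
    * (n%:R * lam ^+ 2).
  rewrite /rho /lam natrD; field; rewrite !lt0r_neq0 //; exact: lt_le_trans s1.
have ov i j : i != j -> #|B i :&: B j|%:R <= D%:R^-1 * l%:R :> R.
  by move=> ij; rewrite mulrC ler_pdivlMr // -natrM ler_nat mulnC; have [_ _ ->] := nd.
have [Bl BE _] := nd.
have l_eps : 24 <= l%:R * eps.
  rewrite -ler_pdivrMr //; apply: le_trans (ltW (archi_boundP _)) _.
    by rewrite divr_ge0 // ltW.
  by rewrite ler_nat (leq_trans _ l0l) // /l0 leqW // leq_addl.
have cost_ge : l%:R ^+ 2 * _ <= _ :=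
  kmeans_cost_ge y1 yz lpos _ t0 _ mP En0 Ez Bl BE ov inj sound into.
rewrite sE' in s1 *; have le_cost := threshold_le s1 al0 eps0 eta_eps eta1 e0 e_eta (ler0n R n)
  (divr_ge0 lnn0 (ltW l2)) _ _ l_eps bad_le.
case: le_cost => [||le0|le_cost].
- by rewrite ler_pdivrMr.
- by rewrite ler1n.
- by apply: le_trans le0 _; apply: sumr_ge0 => a _; exact: sqr_ge0.
apply: le_trans le_cost _; apply: cost_ge.
  by rewrite invr_ge0 ltW.
by lra.
Qed.

(** * Composition of the reduction with a lookup for small instances *)

Lemma NP_hard_reduction (yes no yes' no' : data -> Prop) h : computable h ->
  (forall x, yes x -> yes' (h x)) -> (forall x, no x -> no' (h x)) ->
  NP_hard yes no -> NP_hard yes' no'.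
Proof.
move=> ch hyes hno hard L /hard[f [/polytime_computable cf fP]].
exists (fun x => h (f x)); split; first exact/computable_polytime/computable_comp.
by move=> x; have [Ly Ln] := fP x; split=> [/Ly/hyes|/Ln/hno].
Qed.

(** There are at most 2 ^ N subsets of size y, so all of them can be chosen. *)
Lemma johnson_complete_large y N (E : {set {set 'I_N}}) z k :
  johnson_instance z E k -> (y <= z)%N -> (2 ^ N <= k)%N -> johnson_complete y E k.
Proof.
move=> [Ez En0 _] yz kN; have /set0Pn[T0 T0E] := En0.
have sub T : T \in E -> exists2 S : {set 'I_N}, S \subset T & #|S| = y.
  by move=> TE; apply: exists_subset_card; rewrite Ez.
have [S0 _ S0y] := sub T0 T0E.
pose ys := enum [set A : {set 'I_N} | #|A| == y].
have size_ys : (size ys <= k)%N.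
  rewrite -cardE (leq_trans _ kN) // -[N in leqRHS]card_ord -cardsT -card_powerset.
  by apply/subset_leq_card/subsetP => A _; rewrite inE subsetT.
exists (fun i => nth S0 ys i); split=> [i|T /sub[S ST Sy]].
  have [iys|iys] := ltnP i (size ys); last by rewrite nth_default.
  by have := mem_nth S0 iys; rewrite mem_enum inE => /eqP.
have Sys : S \in ys by rewrite mem_enum inE Sy.
have ik : (index S ys < k)%N by rewrite (leq_trans _ size_ys) ?index_mem.
by exists (Ordinal ik); rewrite /= nth_index.
Qed.

Lemma johnson_complete_not_sound (R : realType) (alpha : R) z y N
    (E : {set {set 'I_N}}) k : alpha < 1 -> johnson_instance z E k ->
  johnson_complete y E k -> ~ johnson_sound alpha y E k.
Proof.
move=> alpha1 [_ En0 _] [S [Sy SE]] /(_ S Sy).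
rewrite (_ : [set T in E | _] = E); last first.
  by apply/setP => T; rewrite inE andb_idr // => /SE/existsP.
have E0 : 0 < #|E|%:R :> R by rewrite ltr0n card_gt0.
by rewrite leNgt -{2}[#|E|%:R]mul1r ltr_pM2r ?alpha1.
Qed.

Lemma computable_johnson_small n0 k0 (s : seq data) (yes0 no0 : data) h :
  computable h ->
  computable (fun x => if (size (dlist (dhd x)) <= n0)%N then
      if (size (dlist (dtl (dtl x))) <= k0)%N then if x \in s then yes0 else no0 else yes0
    else h x).
Proof.
move=> ch; have cid := computable_id.
have size_le n f : computable f -> decidable_in_P (fun x => size (dlist (f x)) <= n)%N.
  move=> cf; have := decidable_size_leq cf (computable_cst (enc_nat n)).
  by rewrite size_dlist_enc_nat.
apply: computable_ifb => //; first exact/size_le/computable_hd.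
apply: computable_ifb; [by apply: size_le; do !apply: computable_tl| |exact: computable_cst].
by apply: computable_ifb; [exact: decidable_mem_cst|exact: computable_cst|exact: computable_cst].
Qed.

Lemma kmeans_instance_le (R : realType) (C C' : R) d (P : {set d.-tuple bool}) k :
  C <= C' -> kmeans_instance C P k -> kmeans_instance C' P k.
Proof.
move=> CC' [P1 k0 dC]; split=> //; apply: le_trans dC _; apply: ler_wpM2r => //.
by rewrite ln_ge0 // ler1n ltnW.
Qed.

Theorem theorem3p25 (R : realType) (alpha : R) (z y : nat)
    (hy : (1 <= y)%N) (hzy : (y < z)%N)
    (hJC : johnson_star_NP_hard alpha z y)
    (eps : R) (heps : 0 < eps) :
  exists rho : R, 0 < rho /\
  exists C : R,
    NP_hard
      (kmeans_yes C rho)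
      (kmeans_no C rho
         (alpha + (1 - alpha) * ((z - y + 1)%:R ^+ 2 / (z - y)%:R ^+ 2) - eps)).
Proof.
have l2 := ln2_gt0 R.
have s0 : 0 < (z - y)%:R :> R by rewrite ltr0n subn_gt0.
set gamma := _ - eps.
(* For alpha >= 1 the ratio of squares, which is at least 1, has a nonpositive weight, so gamma <=
   1. *)
have [alpha1|alpha1] := leP 1 alpha.
  apply: kmeans_NP_hard_le1.
  have : 1 <= (z - y + 1)%:R ^+ 2 / (z - y)%:R ^+ 2 :> R.
    by rewrite ler_pdivlMr ?exprn_gt0 // mul1r -!natrX ler_nat leq_sqr leq_addr.
  by rewrite /gamma; nra.
pose rho : R := ((z - y)%:R / ln 2) ^+ 2.
have rho0 : 0 < rho by rewrite exprn_gt0 // divr_gt0.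
exists rho; split=> //.
have [D [G gap]] := gap_instance hy hzy heps.
have [g [g_oo hard]] := hJC.
have [n0 gn0] : exists n0, forall n, (n0 <= n)%N -> G <= g n.
  by have /cvgryPge/(_ G)[n0 _ H] := g_oo; exists n0 => n; exact: H.
(* In dimension [d0] the antipodes are a no-instance; the absolute value is taken because gamma may
   be negative. *)
pose d0 := (Num.bound (4 * `|gamma * rho| * ln 2 ^+ 2)).+1.
(* The constant covers the dimensions of both the reduced and the fixed instances. *)
pose C : R := ((16 ^ D)%:R + d0%:R) / ln 2.
have d0C : d0%:R <= C * ln 2 by rewrite divfK ?lt0r_neq0 // lerDr.
have [yes0 yes0P] : exists x, kmeans_yes C rho x.
  by apply: kmeans_yes_ex; [exact: ltW|apply: le_trans d0C; rewrite ler1n].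
have [no0 no0P] : exists x, kmeans_no C rho gamma x.
  apply: (@kmeans_no_ex _ _ _ _ d0) => //.
  have : 4 * `|gamma * rho| * ln 2 ^+ 2 < d0%:R.
    apply: lt_trans (archi_boundP _) _; last by rewrite ltr_nat.
    by rewrite mulr_ge0 ?sqr_ge0 // mulr_ge0.
  have : gamma * rho * ln 2 ^+ 2 <= `|gamma * rho| * ln 2 ^+ 2.
    by rewrite ler_wpM2r ?sqr_ge0 // ler_norm.
  have : d0%:R <= d0%:R ^+ 2 :> R by rewrite -natrX ler_nat leq_pmulr.
  by lra.
have [s sP] := small_johnson_instances n0 (2 ^ n0).
pose h := reduction D (letters_data (16 ^ D)).
exists C; apply: NP_hard_reduction hard.
(* The yes-instances in the table are selected classically; as a finite list they are a constant of
   the program. *)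
- exact: (computable_johnson_small n0 (2 ^ n0) [seq x <- s | `[< johnson_star_yes g z y x >]]
    yes0 no0 (computable_reduction D (letters_data (16 ^ D)))).
- move=> x [N [E [k [enc inst star compl]]]].
  have [s' _ xE] := enc; rewrite xE /= !size_dlist_enc_nat -xE.
  case: leqP => [Nn|nN].
    case: leqP => // kk; rewrite mem_filter (sP _ _ _ _ Nn kk enc) andbT.
    by case: asboolP => // -[]; exists N, E, k.
  have [|d [P [encP instP complP _]]] := gap N E k x inst enc.
    apply: le_trans star; rewrite -!mulrA ler_wpM2r ?mulr_ge0 ?exprn_ge0 ?ler0n //.
    exact/gn0/ltnW.
  exists d, P, k; split=> //; last exact: complP.
  by apply: kmeans_instance_le instP; rewrite ler_pM2r ?invr_gt0 // lerDl.
move=> x [N [E [k [enc inst star sound]]]].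
have not_compl : ~ johnson_complete y E k.
  by move=> compl; exact: johnson_complete_not_sound alpha1 inst compl sound.
have [s' _ xE] := enc; rewrite xE /= !size_dlist_enc_nat -xE.
case: leqP => [Nn|nN].
  case: leqP => [kk|kk].
    (* A no-instance listed as a yes-instance would be both complete and sound, which alpha < 1
       excludes. *)
    rewrite mem_filter; case: asboolP => // -[N' [E' [k' [enc' _ _ compl']]]].
    by have := encodes_johnson_inj (Q := johnson_complete y) enc' enc compl'.
  (* Here k exceeds 2 ^ n0 >= 2 ^ N, so the instance would be complete. *)
  case: not_compl; apply: johnson_complete_large inst (ltnW hzy) _.
  by apply: leq_trans (ltnW kk); rewrite leq_exp2l.
have [|d [P [encP instP _ soundP]]] := gap N E k x inst enc.
  apply: le_trans star; rewrite -!mulrA ler_wpM2r ?mulr_ge0 ?exprn_ge0 ?ler0n //.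
  exact/gn0/ltnW.
exists d, P, k; split=> //; last exact: soundP.
by apply: kmeans_instance_le instP; rewrite ler_pM2r ?invr_gt0 // lerDl.
Qed.
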